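(* Let $\mathcal{H}$ be a finite-dimensional real Hilbert space and let $F=f+g+h$ on $\mathcal{H}$, where: (1) $f\colon \mathcal{H}\to\mathbb{R}$ is a differentiable $\alpha$-convex function with $\kappa$-Lipschitz continuous gradient and $\alpha\ge-\kappa$; (2) $g\colon\mathcal{H}\to(-\infty,+\infty]$ is a proper lower semicontinuous function; (3) $h=\bar h-\underline h$, where $\bar h\colon\mathcal{H}\to\mathbb{R}$ is a differentiable function with $\ell$-Lipschitz continuous gradient and $\underline h\colon\mathcal{H}\to\mathbb{R}$ is a continuous convex function. Suppose that $F$ is coercive. Let $\gamma\in(0,+\infty)$, $\theta\in(0,1]$, $\eta\in(0,+\infty)$, and let $(x_n,y_n,z_n,y^*_{n-1})_{n\in\mathbb{N}^\ast}$ be a sequence generated by the DRFDR algorithm (described in the context) with these parameters. Suppose that one of the following holds: (a) $\kappa>0$, $\eta\in(0,2)$ if $\ell=0$, $\eta\in[1,2)$ if $\ell>0$, and $\gamma\in(0,\overline\gamma)$; or (b) $\kappa>0$, $\eta\in\left[2,\,2+\frac{2\kappa}{\theta(\kappa+\ell)}\right)$, $\alpha>\frac{(3\eta-2)\theta\ell+2\sqrt{2(\eta-2)\theta\kappa(\kappa+\ell)}}{\eta\theta+2-2\theta}$, and $\gamma\in(\underline\gamma,\overline\gamma)$; or (c) $\kappa=0$, $\eta\in(0,2)$, $\gamma\in\left(0,\frac{1}{\theta\ell}\right)$ if $\eta\le1$, and $\gamma\in\left(0,\frac{2-\eta}{(3\eta-2)\theta\ell}\right)$ if $\eta>1$ (with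 the convention $\frac{1}{\theta\ell}=\frac{2-\eta}{(3\eta-2)\theta\ell}=+\infty$ when $\ell=0$), where (for $\kappa>0$) $$\underline\gamma:=\frac{(\eta\theta+2-2\theta)\alpha-(3\eta-2)\theta\ell-\sqrt{\Delta}}{4\theta\kappa(\kappa+\ell)},\qquad \overline\gamma:=\frac{(\eta\theta+2-2\theta)\alpha-(3\eta-2)\theta\ell+\sqrt{\Delta}}{4\theta\kappa(\kappa+\ell)}$$ with $\Delta:=\left((\eta\theta+2-2\theta)\alpha-(3\eta-2)\theta\ell\right)^2-8(\eta-2)\theta\kappa(\kappa+\ell)$. Then the following hold: (i) The sequence $(x_n,y_n,z_n,y^*_{n-1})_{n\in\mathbb{N}^\ast}$ is bounded and $$\sum_{n=1}^{+\infty}\|(x_{n+1},y_{n+1},z_{n+1})-(x_n,y_n,z_n)\|^2<+\infty.$$ Consequently, $(x_{n+1},y_{n+1},z_{n+1})-(x_n,y_n,z_n)\to0$ as $n\to+\infty$. (ii) For every cluster point $(\overline x,\overline y,\overline z)$ of $(x_n,y_n,z_n)_{n\in\mathbb{N}^\ast}$, it holds that $\overline x=\overline y$, $$\lim_{n\to+\infty}L_n=\lim_{n\to+\infty}F(y_n)=F(\overline y),\quad\text{and}\quad 0\in\partial(f+g+\bar h)(\overline y)-\partial\underline h(\overline y),$$ where $L_n$ is the quantity defined in the context.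
   Context: $\mathbb{N}$ is the set of nonnegative integers and $\mathbb{N}^\ast$ the set of positive integers. The constants satisfy $\kappa,\ell\in[0,+\infty)$ and $\alpha\in\mathbb{R}$. A function $f\colon\mathcal{H}\to(-\infty,+\infty]$ is $\alpha$-convex ($\alpha\in\mathbb{R}$) if $f((1-\lambda)x+\lambda y)+\frac{\alpha}{2}\lambda(1-\lambda)\|x-y\|^2\le(1-\lambda)f(x)+\lambda f(y)$ for all $x,y\in\operatorname{dom}f$ and $\lambda\in(0,1)$. It is coercive if $f(x)\to+\infty$ as $\|x\|\to+\infty$. Subdifferentials: for a proper lower semicontinuous $f$ and $x\in\operatorname{dom}f$, the regular subdifferential is $\widehat\partial f(x)=\{x^*:\liminf_{y\to x}\frac{f(y)-f(x)-\langle x^*,y-x\rangle}{\|y-x\|}\ge0\}$, and $\partial f(x)$ is the limiting subdifferential, the set of $x^*$ for which there exist $x_n\to x$ and $x_n^*\in\widehat\partial f(x_n)$ with $f(x_n)\to f(x)$ and $x_n^*\to x^*$; both are empty if $x\notin\operatorname{dom}f$. For convex functions $\partial$ is the usual convex subdifferential. The difference of two sets is the Minkowski difference $A-B=\{a-b:a\in A,b\in B\}$. Proximity operator (set-valued): $\operatorname{Prox}_{\gamma f}(x)=\operatorname{argmin}_{z\in\mathcal{H}}\left(f(z)+\frac{1}{2\gamma}\|z-x\|^2\right)$. DRFDR algorithm: given $y_0,z_0\in\mathcal{H}$, for each $n\in\mathbb{N}$ choose $y_n^*\in\partial\underline h(y_n)$ and find $$x_{n+1}\in\operatorname{Prox}_{\gamma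 f}(z_n),$$ $$y_{n+1}\in\operatorname{Prox}_{\theta\gamma g}\big((\theta+1)x_{n+1}-\theta z_n-\theta\gamma\nabla\bar h(x_{n+1})+\theta\gamma y_n^*\big),$$ $$z_{n+1}=z_n+\eta(y_{n+1}-x_{n+1}).$$ For $n\in\mathbb{N}^\ast$, $$L_n=f(x_n)+g(y_n)+\bar h(x_n)+\langle\nabla\bar h(x_n),y_n-x_n\rangle-\underline h(y_{n-1})-\langle y^*_{n-1},y_n-y_{n-1}\rangle+\frac1\gamma\langle z_n-x_n,y_n-x_n\rangle-\frac{2\eta\theta-1}{2\theta\gamma}\|y_n-x_n\|^2.$$ *)

(* Defs.v *)
From HB Require Import structures.
From mathcomp Require Import all_boot all_order all_algebra.
From mathcomp Require Import all_classical all_reals all_analysis.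

Set Implicit Arguments.
Unset Strict Implicit.
Unset Printing Implicit Defensive.

Import Order.TTheory GRing.Theory Num.Theory.
Import numFieldNormedType.Exports.

Local Open Scope classical_set_scope.
Local Open Scope ring_scope.

(* Finite-dimensional real Hilbert spaces: [Vector] provides the finite
   dimension, and the norm (hence the topology) is the one of the inner
   product.  Completeness is automatic in finite dimension. *)
HB.mixin Record NormedModule_Vector_isFinHilbert (R : realType) H
    & NormedModule R H & Vector R H := {
  inner : {dot H for (@idfun R)} ;
  norm_inner : forall u : H, `|u| = Num.sqrt (inner u u)
}.

#[short(type="finHilbertType")]
HB.structure Definition FinHilbert (R : realType) :=
  {H of NormedModule R H & Vector R H
   & NormedModule_Vector_isFinHilbert R H}.

Section convex_analysis.
Context {R : realType} {H : finHilbertType R}.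
Implicit Types (u v x y : H) (f : H -> \bar R) (phi : H -> R).

(* Riesz representative of the differential; it exists and is unique at every
   point of differentiability. *)
Definition grad phi x : H :=
  xget 0 [set v : H | forall u : H, 'd phi x u = inner v u].

Definition dom f : set H := [set x | (f x < +oo)%E].

Definition proper_fun f := (forall x, -oo < f x)%E /\ dom f !=set0.

Definition alpha_convex (alpha : R) f :=
  forall x y (t : R), dom f x -> dom f y -> 0 < t < 1 ->
    (f ((1 - t) *: x + t *: y)%R
       + (alpha / 2 * t * (1 - t) * `|x - y| ^+ 2)%:E
     <= (1 - t)%:E * f x + t%:E * f y)%E.

Definition coercive f :=
  forall A : R, exists M : R, forall x, M < `|x| -> (A%:E < f x)%E.

Definition regular_subdiff f x : set H :=
  [set v | dom f x /\
     (0 <= limf_einf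
             (fun y => (f y - f x - (inner v (y - x))%:E) * (`|y - x|^-1)%:E)
             x^')%E].

Definition limiting_subdiff f x : set H :=
  [set v | dom f x /\ exists (s w : nat -> H),
     [/\ s n @[n --> \oo] --> x,
         forall n, regular_subdiff f (s n) (w n),
         f (s n) @[n --> \oo] --> f x &
         w n @[n --> \oo] --> v]].

Definition convex_subdiff phi x : set H :=
  [set v | forall y, phi x + inner v (y - x) <= phi y].

Definition argmin f : set H := [set z | forall w, (f z <= f w)%E].

Definition prox (gamma : R) f x : set H :=
  argmin (fun z => (f z + ((2 * gamma)^-1 * `|z - x| ^+ 2)%:E)%E).

(* The norm of the Hilbert space H x H x H; the library equips products with
   the max norm. *)
Definition hnorm3 (p : H * H * H) : R :=
  Num.sqrt (`|p.1.1| ^+ 2 + `|p.1.2| ^+ 2 + `|p.2| ^+ 2).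

End convex_analysis.

Section DRFDR.
Context {R : realType} {H : finHilbertType R}.
Variables (f : H -> R) (g : H -> \bar R) (hbar hund : H -> R).

Definition objective (x : H) : \bar R :=
  ((f x)%:E + g x + (hbar x - hund x)%:E)%E.

Variables (gamma theta eta : R) (x y z ys : nat -> H).

(* [ys n] is the subgradient y_n^*; [x 0] is not part of the algorithm and is
   left unconstrained. *)
Definition DRFDR_seq := forall n,
  [/\ convex_subdiff hund (y n) (ys n),
      prox gamma (EFin \o f) (z n) (x n.+1),
      prox (theta * gamma) g
        ((theta + 1) *: x n.+1 - theta *: z n
           - (theta * gamma) *: grad hbar (x n.+1) + (theta * gamma) *: ys n)
        (y n.+1) &
      z n.+1 = z n + eta *: (y n.+1 - x n.+1)].

(* Only meaningful for n >= 1, because of the index n - 1. *)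
Definition DRFDR_merit (n : nat) : \bar R :=
  ((f (x n))%:E + g (y n)
   + (hbar (x n) + inner (grad hbar (x n)) (y n - x n)
      - hund (y n.-1) - inner (ys n.-1) (y n - y n.-1)
      + gamma^-1 * inner (z n - x n) (y n - x n)
      - (2 * eta * theta - 1) / (2 * theta * gamma) * `|y n - x n| ^+ 2)%:E)%E.

End DRFDR.

Section stepsize_bounds.
Context {R : realType}.
Variables (alpha kappa ell theta eta : R).

Let b : R := (eta * theta + 2 - 2 * theta) * alpha
             - (3 * eta - 2) * theta * ell.

Definition Delta : R :=
  b ^+ 2 - 8 * (eta - 2) * theta * kappa * (kappa + ell).

Definition gamma_lower : R :=
  (b - Num.sqrt Delta) / (4 * theta * kappa * (kappa + ell)).

Definition gamma_upper : R :=
  (b + Num.sqrt Delta) / (4 * theta * kappa * (kappa + ell)).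

End stepsize_bounds.

(* Main.v *)
From HB Require Import structures.
Require Import Defs.
From mathcomp Require Import all_boot all_order all_algebra.
From mathcomp Require Import all_classical all_reals all_analysis.
From mathcomp Require Import ring lra.

Set Implicit Arguments.
Unset Strict Implicit.
Unset Printing Implicit Defensive.

Import Order.TTheory GRing.Theory Num.Theory.
Import numFieldNormedType.Exports.

Local Open Scope classical_set_scope.
Local Open Scope ring_scope.

(** Since f is differentiable, the first prox step says that
    z_n = x_{n+1} + gamma grad f(x_{n+1}).  Substituting this in the second
    step turns it into an exact minimization: y_{n+1} minimizes
    g + s(x_{n+1}, .) - <y_n^*, .>, where s(a, .) is the quadratic surrogate of
    f + hbar at a, namely the sum of their linearizations at a and of
    c |. - a|^2 with c = 1 / (2 theta gamma) ([argmin_surrogate]).  The same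
    substitution turns the merit L_{n+1} into
    g(y_{n+1}) + s(x_{n+1}, y_{n+1}) minus the linearization of hund at y_n
    ([merit_surrogate]), and two facts then make L a Lyapunov function.

    First, L decreases.  Optimality of y_{n+2} and the subgradient inequality
    for hund bound L_{n+1} - L_{n+2} below by
    s(x_{n+1}, y_{n+1}) - s(x_{n+2}, y_{n+1}).  The update of z gives
    eta (y_{n+1} - x_{n+1}) as x_{n+2} - x_{n+1} plus gamma times the increment
    of grad f, so this difference is a quadratic expression in the increments
    of x, grad f and grad hbar, and it is at least
    delta |x_{n+2} - x_{n+1}|^2 ([merit_decrease]).  The sign of delta is that
    of a quadratic polynomial in gamma whose roots are gamma_lower and
    gamma_upper ([decrease_rate_gt0]).

    Second, L dominates F: the surrogate at x_n overestimates f + hbar at y_n by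
    at least sigma |y_n - x_n|^2, where sigma > 0 because the step size bounds
    also force theta gamma (kappa + ell) < 1 ([theta_gamma_smoothness_lt1]).

    Coercivity then bounds y_n, hence all the sequences, and F(y_n) is bounded
    below, so L converges and the squared steps are summable.  All steps are
    controlled by the increments of x, which gives y_n - x_n -> 0 and
    L_n - F(y_n) -> 0.  Along a subsequence on which y_n^* converges as well,
    comparing the minimizer y_{n+1} with the cluster point yb gives
    limsup g(y_{n+1}) <= g(yb), and lower semicontinuity gives the converse;
    this identifies the limit of L with F(yb).  Finally the optimality of
    y_{n+1} exhibits a regular subgradient of f + g + hbar at y_{n+1} which
    differs from y_n^* by a vanishing quantity, so that the limit of the y_n^*
    belongs to both subdifferentials ([cluster_point_critical]). *)

(** * Inner product, Riesz representation and compactness *)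

Section inner_product.
Context {R : realType} {H : finHilbertType R}.
Implicit Types (u v w : H) (a b : R).

Lemma innerC u v : inner u v = inner v u.
Proof. by rewrite hermC expr0 mul1r. Qed.

Lemma innerDl u v w : inner (u + v) w = inner u w + inner v w.
Proof. exact: linearDl. Qed.

Lemma innerDr u v w : inner w (u + v) = inner w u + inner w v.
Proof. exact: linearD. Qed.

Lemma innerNl u w : inner (- u) w = - inner u w.
Proof. exact: linearNl. Qed.

Lemma innerNr u w : inner w (- u) = - inner w u.
Proof. exact: linearN. Qed.

Lemma innerZl a u w : inner (a *: u) w = a * inner u w.
Proof. by rewrite linearZl. Qed.

Lemma innerZr a u w : inner w (a *: u) = a * inner w u.
Proof. by rewrite linearZ. Qed.

Lemma inner0l w : inner 0 w = 0. Proof. exact: linear0l. Qed.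

Lemma inner0r w : inner w 0 = 0. Proof. exact: linear0. Qed.

Definition innerE := (innerDl, innerDr, innerNl, innerNr, innerZl, innerZr).

Lemma inner_ge0 u : 0 <= inner u u.
Proof.
have [->|u0] := eqVneq u 0; first by rewrite inner0l.
exact/ltW/neq0_dnorm_gt0.
Qed.

Lemma sqr_normE u : `|u| ^+ 2 = inner u u.
Proof. by rewrite norm_inner sqr_sqrtr// inner_ge0. Qed.

Lemma inner_eq0 u : inner u u = 0 -> u = 0.
Proof. by rewrite -sqr_normE => /eqP; rewrite sqrf_eq0 normr_eq0 => /eqP. Qed.

Lemma cauchy_schwarz u v : `|inner u v| <= `|u| * `|v|.
Proof.
have [->|v0] := eqVneq v 0; first by rewrite inner0r !normr0 mulr0.
have vv : 0 < inner v v by exact: neq0_dnorm_gt0.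
rewrite -(@ler_pXn2r _ 2)// ?nnegrE ?mulr_ge0// exprMn !sqr_normE.
rewrite real_normK ?num_real//.
have := inner_ge0 (u - (inner u v / inner v v) *: v).
have -> : inner (u - (inner u v / inner v v) *: v)
    (u - (inner u v / inner v v) *: v) = inner u u - inner u v ^+ 2 / inner v v.
  by rewrite !innerE (innerC v u); field; rewrite gt_eqF.
by rewrite subr_ge0 ler_pdivrMr.
Qed.

Lemma inner_le_norm u v : inner u v <= `|u| * `|v|.
Proof. exact: le_trans (ler_norm _) (cauchy_schwarz u v). Qed.

Lemma inner_cvg (T : Type) (F : set_system T) {FF : Filter F} (f g : T -> H) u v :
  f @ F --> u -> g @ F --> v -> inner (f t) (g t) @[t --> F] --> inner u v.
Proof.
(* polarization reduces this to the continuity of the norm *)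
have polar (p q : H) : inner p q = (`|p + q| ^+ 2 - `|p - q| ^+ 2) / 4.
  by rewrite !sqr_normE !innerE (innerC q p); field.
move=> fu gv; rewrite polar.
under eq_fun do rewrite polar.
apply: cvgMl; apply: cvgB; rewrite expr2.
- under eq_fun do rewrite expr2.
  by apply: cvgM; apply: cvg_norm; exact: cvgD.
- under eq_fun do rewrite expr2.
  by apply: cvgM; apply: cvg_norm; exact: cvgB.
Qed.

(** An endomorphism whose value encodes all the products of v with a basis; it is
    injective because only 0 is orthogonal to a basis, hence onto by
    finiteness of the dimension, and a preimage of the vector with coefficients
    phi(b_i) represents phi. *)
Let gram (v : H) : H :=
  \sum_(i < \dim {:H}) inner v (vbasis {:H})`_i *: (vbasis {:H})`_i.

Let gram_is_linear : linear gram.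
Proof.
move=> a u v; rewrite /gram scaler_sumr -big_split/=; apply: eq_bigr => i _.
by rewrite !innerE scalerDl scalerA.
Qed.

HB.instance Definition _ := GRing.isLinear.Build R H H *:%R gram gram_is_linear.

Let inner_basis_eq0 v :
  (forall i : 'I_(\dim {:H}), inner v (vbasis {:H})`_i = 0) -> v = 0.
Proof.
move=> vi; apply: inner_eq0; rewrite {2}(coord_vbasis (memvf v)) linear_sum/=.
by rewrite big1// => i _; rewrite innerZr vi mulr0.
Qed.

Let basis_coef_inj (c d : 'I_(\dim {:H}) -> R) :
    \sum_(i < \dim {:H}) c i *: (vbasis {:H})`_i =
    \sum_(i < \dim {:H}) d i *: (vbasis {:H})`_i ->
  c =1 d.
Proof.
move=> cd i; apply/eqP; rewrite -subr_eq0; apply/eqP; move: i.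
have /freeP/(_ (fun i => c i - d i)) := basis_free (vbasisP {:H}); apply.
under eq_bigr do rewrite scalerBl.
by rewrite sumrB cd subrr.
Qed.

Lemma riesz_representation (phi : H -> R) :
  linear_for *%R phi -> exists v, forall u, phi u = inner v u.
Proof.
move=> phil.
have phiD u v : phi (u + v) = phi u + phi v.
  by have := phil 1 u v; rewrite scale1r mul1r.
have phi0 : phi 0 = 0 by have := phiD 0 0; rewrite addr0; lra.
have phiZ a u : phi (a *: u) = a * phi u.
  by have := phil a u 0; rewrite phi0 !addr0.
have ker0 : lker (linfun gram) == 0%VS.
  apply/lker0P => u v; rewrite !lfunE/= => guv.
  apply/eqP; rewrite -subr_eq0; apply/eqP/inner_basis_eq0 => i.
  by rewrite innerDl innerNl (basis_coef_inj guv) subrr.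
pose w := \sum_(i < \dim {:H}) phi (vbasis {:H})`_i *: (vbasis {:H})`_i.
have := lker0_lfunVK ker0 w; set v := ((linfun gram)^-1)%VF w.
rewrite lfunE/= => /basis_coef_inj vb.
exists v => u; rewrite (coord_vbasis (memvf u)) linear_sum/=.
have -> (I : finType) (c : I -> H) : phi (\sum_i c i) = \sum_i phi (c i).
  by apply: (big_morph phi).
by apply: eq_bigr => i _; rewrite phiZ innerZr vb.
Qed.

(** [grad] is a choice operator, which returns a representative of the
    differential only if there is one: finite dimension provides it. *)
Lemma gradE (phi : H -> R) x :
  differentiable phi x -> forall u, 'd phi x u = inner (grad phi x) u.
Proof.
move=> dphi; rewrite /grad; case: xgetP => [v _ //|nov].
have [|v vE] := @riesz_representation ('d phi x).
  by move=> a u v; rewrite linearP.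
by case: (nov v).
Qed.

(** The Riesz representatives of the coordinate functions bound the coordinates
    of a vector by its norm, so a ball lies in the continuous image of a box of
    coordinates. *)
Lemma closed_ball0_sub_compact (r : R) :
  exists2 K : set H, compact K & forall u, `|u| <= r -> K u.
Proof.
pose b := vbasis {:H}.
have cv i : exists v, forall u, coord b i u = inner v u.
  by apply: riesz_representation => a u v; rewrite linearP.
pose e i := projT1 (cid (cv i)).
have eP i u : coord b i u = inner (e i) u by rewrite /e; case: cid.
pose g (c : 'rV[R]_(\dim {:H})) : H := \sum_i c ord0 i *: b`_i.
exists (g @` [set c : 'rV[R]_(\dim {:H}) |
    forall i, `[- (`|e i| * r), `|e i| * r]%classic (c ord0 i)]).
  apply: continuous_compact; last first.
    apply: (@rV_compact R _ (fun i => `[- (`|e i| * r), `|e i| * r]%classic)) => i.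
    exact: segment_compact.
  apply: continuous_subspaceT => c; rewrite /g.
  apply: cvg_big => [| |i _]; [exact: add_continuous|exact: nbhs_filter|].
  by apply: cvgZr_tmp; [exact: nbhs_filter|exact: coord_continuous].
move=> u ur; exists (\row_i coord b i u).
  move=> i /=; rewrite mxE eP in_itv/= -ler_norml.
  by rewrite (le_trans (cauchy_schwarz _ _))// ler_wpM2l.
rewrite /g [RHS](coord_vbasis (memvf u)).
by apply: eq_bigr => i _; rewrite mxE.
Qed.

Lemma continuous_bounded_ball0 (q : H -> R) : continuous q ->
  forall r : R, exists C, forall u, `|u| <= r -> `|q u| <= C.
Proof.
move=> cq r; have [K cK rK] := closed_ball0_sub_compact r.
have /compact_bounded[M [_ MP]] : compact (q @` K).
  by apply: continuous_compact => //; exact: continuous_subspaceT.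
exists (M + 1) => u /rK Ku; apply: (MP (M + 1)); first by rewrite ltrDl.
by exists u.
Qed.

End inner_product.

(** * Functions with Lipschitz gradient *)

Section smooth_functions.
Context {R : realType} {H : finHilbertType R}.
Implicit Types (u v x y : H) (phi : H -> R).

Lemma lipschitz_setTP (V W : normedModType R) (k : R) (G : V -> W) :
  k.-lipschitz G -> forall p q : V, `|G p - G q| <= k * `|p - q|.
Proof. by move=> Gk p q; apply: (Gk (p, q)). Qed.

(** Mean value theorem for psi minus the primitive of its affine bound. *)
Lemma increment_le_quadratic (psi dpsi : R -> R) (c k : R) :
    (forall t : R, is_derive t 1 psi (dpsi t)) ->
    (forall t, 0 < t < 1 -> dpsi t <= c + k * t) ->
  psi 1 - psi 0 <= c + k / 2.
Proof.
move=> dP dle.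
pose q t := psi t - (c * t + k / 2 * t ^+ 2).
have dq (t : R) : is_derive t 1 q (dpsi t - (c + k * t)).
  rewrite /q; apply: is_derive_eq.
  by rewrite /GRing.scale/=; field.
have [|t tI] := @MVT R q (fun t => dpsi t - (c + k * t)) 0 1 ltr01 (fun t _ => dq t).
  by apply: derivable_within_continuous => t _; exact: ex_derive.
move: tI; rewrite in_itv/= => tI; have := dle _ tI; rewrite /q.
by rewrite expr1n expr0n/=; lra.
Qed.

Lemma is_derive_line phi x d (t : R) : differentiable phi (x + t *: d) ->
  is_derive t 1 (fun s : R => phi (x + s *: d)) (inner (grad phi (x + t *: d)) d).
Proof.
move=> dphi; have der : derivable phi (x + t *: d) d by exact: diff_derivable.
have E : (fun h : R => h^-1 *: (((fun s : R => phi (x + s *: d)) \o shift t) (h *: 1)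
      - phi (x + t *: d))) =
    (fun h : R => h^-1 *: ((phi \o shift (x + t *: d)) (h *: d) - phi (x + t *: d))).
  apply/funext => h; congr (_ *: (_ - _)); rewrite /shift/=; congr phi.
  by rewrite (mulr1 h : h *: (1 : R) = h) scalerDl addrCA.
split; first by rewrite /derivable E.
by rewrite /derive E -gradE// -deriveE.
Qed.

(** Along the segment from x to y the derivative of phi deviates from its initial
    value by at most L |y - x|^2 t, so its integral deviates by L / 2 |y - x|^2. *)
Lemma descent_bound phi (L : R) : (forall u, differentiable phi u) ->
    L.-lipschitz (grad phi) ->
  forall x y, `|phi y - phi x - inner (grad phi x) (y - x)| <= L / 2 * `|y - x| ^+ 2.
Proof.
move=> dphi /lipschitz_setTP Lphi x y; set d := y - x.
pose psi (t : R) := phi (x + t *: d).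
have dpsi (t : R) : is_derive t 1 psi (inner (grad phi (x + t *: d)) d).
  exact: is_derive_line.
have dist t : 0 < t < 1 ->
    `|inner (grad phi (x + t *: d)) d - inner (grad phi x) d| <= L * `|d| ^+ 2 * t.
  move=> /andP[t0 _]; rewrite -innerNl -innerDl.
  apply: le_trans (cauchy_schwarz _ _) _.
  rewrite expr2 mulrA mulrAC ler_wpM2r//.
  apply: le_trans (Lphi _ _) _.
  by rewrite addrC addKr normrZ gtr0_norm// [t * _]mulrC mulrA.
have psi0 : psi 0 = phi x by rewrite /psi scale0r addr0.
have psi1 : psi 1 = phi y by rewrite /psi scale1r addrC subrK.
have split_norm (p q r : R) : `|p - q| <= r -> (p <= q + r) * (- p <= - q + r).
  by rewrite ler_norml => /andP[? ?]; split; lra.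
have upper (p q r a : R) : p - q <= r + L * a / 2 -> p - q - r <= L / 2 * a.
  by lra.
have lower (p q r a : R) : - p - - q <= - r + L * a / 2 -> - (L / 2 * a) <= p - q - r.
  by lra.
rewrite ler_norml; apply/andP; split.
- have := @increment_le_quadratic (\- psi) (fun t => - inner (grad phi (x + t *: d)) d)
    (- inner (grad phi x) d) (L * `|d| ^+ 2).
  rewrite /= psi0 psi1 => inc.
  by apply/lower/inc => t /dist/split_norm[].
- have := @increment_le_quadratic psi (fun t => inner (grad phi (x + t *: d)) d)
    (inner (grad phi x) d) (L * `|d| ^+ 2) dpsi.
  rewrite psi0 psi1 => inc.
  by apply/upper/inc => t /dist/split_norm[].
Qed.

(** Convexity on the segment from x to y at parameter t, divided by t, where
    [descent_bound] replaces the difference quotient by the gradient up to a term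
    of order t; then t tends to 0. *)
Lemma alpha_convex_le (alpha L : R) phi : (forall u, differentiable phi u) ->
    L.-lipschitz (grad phi) -> alpha_convex alpha (EFin \o phi) ->
  forall x y, phi x + inner (grad phi x) (y - x) + alpha / 2 * `|y - x| ^+ 2 <= phi y.
Proof.
move=> dphi Lphi cvx x y.
have desc := descent_bound dphi Lphi x.
set s := inner _ _; set a := `|y - x| ^+ 2.
have a0 : 0 <= a by exact: sqr_ge0.
have step (t : R) : 0 < t < 1 ->
    s - L / 2 * t * a + alpha / 2 * (1 - t) * a <= phi y - phi x.
  move=> t01; have /andP[t0 t1] := t01.
  have := cvx x y t (ltry _) (ltry _) t01.
  rewrite /= -!EFinM -!EFinD lee_fin distrC -/a.
  have -> : (1 - t) *: x + t *: y = x + t *: (y - x).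
    by rewrite scalerBl scale1r scalerBr addrAC addrA.
  move=> c1; have := desc (x + t *: (y - x)).
  rewrite [x + _ - x]addrC addKr normrZ exprMn innerZr -/s -/a (gtr0_norm t0).
  rewrite ler_norml => /andP[c2 _].
  have -> : s - L / 2 * t * a + alpha / 2 * (1 - t) * a =
    (t * s - L / 2 * (t ^+ 2 * a) + alpha / 2 * t * (1 - t) * a) / t.
    by field; rewrite gt_eqF.
  by rewrite ler_pdivrMr//; lra.
(* Both error terms in t are absorbed in k t, and t is chosen with k t <= e. *)
rewrite -subr_le0; apply/ler_addgt0Pl => e e0; rewrite addr0.
pose k := `|L / 2 * a + alpha / 2 * a| + 1.
have k0 : 0 < k by rewrite /k ltr_wpDl.
pose t := Num.min (1 / 2) (e / k).
have t0 : 0 < t by rewrite lt_min !divr_gt0.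
have t1 : t < 1 by rewrite gt_min; apply/orP; left; lra.
have te : t * k <= e by rewrite -ler_pdivlMr// ge_min lexx orbT.
have := step t; rewrite t0 t1 => /(_ isT).
have : t * (L / 2 * a + alpha / 2 * a) <= t * k.
  apply: ler_wpM2l; first exact: ltW.
  by apply: le_trans (ler_norm _) _; rewrite lerDl.
lra.
Qed.

(** Fermat's rule: by [descent_bound], a step of length t in the direction of the
    residual v decreases the prox objective by t |v|^2 / gamma up to a term of
    order t^2, so minimality forces v = 0. *)
Lemma prox_smoothE (L gamma : R) phi x z : 0 < gamma ->
    (forall u, differentiable phi u) -> L.-lipschitz (grad phi) ->
  prox gamma (EFin \o phi) z x -> z = x + gamma *: grad phi x.
Proof.
move=> g0 dphi Lphi xmin.
have [v vdef] : exists v, v = z - x - gamma *: grad phi x by eexists.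
suff : v = 0.
  by rewrite vdef => /eqP; rewrite subr_eq0 subr_eq addrC => /eqP.
apply: inner_eq0; apply/eqP; rewrite eq_le inner_ge0 andbT.
set a := inner v v.
have a0 : 0 <= a by exact: inner_ge0.
have step (t : R) : 0 < t -> a <= t * ((gamma * L + 1) / 2 * a).
  move=> t0.
  have := xmin (x + t *: v); rewrite -!EFinD lee_fin.
  have := descent_bound dphi Lphi x (x + t *: v).
  rewrite [x + _ - x]addrC addKr normrZ exprMn real_normK ?num_real//.
  rewrite innerZr [`|v| ^+ 2]sqr_normE -/a.
  rewrite ler_norml => /andP[_ d1].
  have -> : x + t *: v - z = (x - z) + t *: v by rewrite addrAC.
  rewrite !sqr_normE !innerE -/a (innerC v x) (innerC v z).
  have vE : inner z v - inner x v = a + gamma * inner (grad phi x) v.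
    have := congr1 (inner^~ v) vdef; rewrite /= !innerE -/a; lra.
  move=> d2.
  have : 0 <= (gamma * 2) * (t * inner (grad phi x) v + L / 2 * (t ^+ 2 * a)
       + (2 * gamma)^-1 * (2 * t * (inner x v - inner z v) + t ^+ 2 * a)).
    apply: mulr_ge0; [lra|].
    have h : 0 < (2 * gamma)^-1 by rewrite invr_gt0; lra.
    set c := (2 * gamma)^-1 in d2 h *; lra.
  have -> : (gamma * 2) * (t * inner (grad phi x) v + L / 2 * (t ^+ 2 * a)
       + (2 * gamma)^-1 * (2 * t * (inner x v - inner z v) + t ^+ 2 * a)) =
    2 * t * (- a + t * ((gamma * L + 1) / 2 * a)).
    have -> : inner x v - inner z v = - (a + gamma * inner (grad phi x) v) by lra.
    by field; rewrite gt_eqF.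
  by rewrite pmulr_rge0 ?mulr_gt0// addrC subr_ge0.
apply/ler_addgt0Pl => e e0; rewrite addr0.
pose k := `|(gamma * L + 1) / 2 * a| + 1.
have k0 : 0 < k by rewrite /k ltr_wpDl.
have := step (e / k); rewrite divr_gt0// => /(_ isT) /le_trans; apply.
rewrite mulrAC ler_pdivrMr//; apply: ler_wpM2l; first exact: ltW.
by apply: le_trans (ler_norm _) _; rewrite lerDl.
Qed.

End smooth_functions.

(** * Subgradients *)

Section subdifferentials.
Context {R : realType} {H : finHilbertType R}.
Implicit Types (u v p : H) (G : H -> \bar R).

(** The difference quotient at u is at least - C |u - p|. *)
Lemma quadratic_minorant_regular_subdiff G p v (C : R) : G p \is a fin_num ->
    (forall u, (G p + (inner v (u - p) - C * `|u - p| ^+ 2)%:E <= G u)%E) ->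
  regular_subdiff G p v.
Proof.
move=> Gp minorant; rewrite /regular_subdiff/=; split.
  by rewrite /dom/= ltey_eq Gp.
rewrite limf_einfE; apply/lee_addgt0Pr => e e0.
rewrite -leeBlDr// sub0e.
pose k := `|C| + 1.
have k0 : 0 < k by rewrite /k ltr_wpDl.
pose V := [set u | u != p /\ `|u - p| * k <= e].
apply: (@le_trans _ _ (ereal_inf ((fun u =>
    ((G u - G p - (inner v (u - p))%:E) * (`|u - p|^-1)%:E)%E) @` V))).
  apply: le_ereal_inf_tmp => _ [u [up ue] <-].
  have n0 : 0 < `|u - p| by rewrite normr_gt0 subr_eq0.
  have ni0 : 0 < `|u - p|^-1 by rewrite invr_gt0.
  have := minorant u; rewrite -(fineK Gp).
  case: (G u) => [s| |]; last by [].
  - rewrite -EFinD lee_fin => le_s; rewrite -!EFinB -EFinM -EFinN lee_fin.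
    rewrite ler_pdivlMr// mulNr lerNl.
    have : C * `|u - p| ^+ 2 <= e * `|u - p|.
      rewrite expr2 mulrA ler_wpM2r// (le_trans _ ue)// mulrC.
      by rewrite ler_wpM2l// /k (le_trans (ler_norm _))// lerDl.
    move: le_s; move: (inner _ _) (fine _) (C * _) (e * _) => i0 i1 i2 i3; lra.
  - by move=> _; rewrite -EFinN !addye// gt0_mulye// leey.
apply: ereal_sup_ubound; exists V => //.
rewrite /V /dnbhs /within/=.
apply/nbhs_normP; exists (e / k) => /=; first exact: divr_gt0.
move=> u /=; rewrite distrC => ue up; split => //.
by rewrite -ler_pdivlMr// ltW.
Qed.

(** The subgradient inequality is tested at distance 1 in the direction of v. *)
Lemma subgradient_norm_le (phi : H -> R) p v (A B : R) : convex_subdiff phi p v ->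
    (forall u, `|u - p| <= 1 -> A <= phi u <= B) -> `|v| <= B - A.
Proof.
move=> vp bnd.
have /andP[Ap pB] : A <= phi p <= B by apply: bnd; rewrite subrr normr0.
have AB : A <= B by exact: le_trans pB.
have [->|v0] := eqVneq v 0; first by rewrite normr0 subr_ge0.
have n0 : 0 < `|v| by rewrite normr_gt0.
pose u := p + `|v|^-1 *: v.
have up : u - p = `|v|^-1 *: v by rewrite /u addrAC subrr add0r.
have := vp u; rewrite up innerZr -sqr_normE expr2 mulKf ?gt_eqF// => le_u.
have /andP[_ uB] : A <= phi u <= B.
  by apply: bnd; rewrite up normrZ ger0_norm ?invr_ge0// mulVf// gt_eqF.
by rewrite lerBrDr; lra.
Qed.

End subdifferentials.

(** * Subsequences *)

Section subsequences.
Context {R : realType}.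

Lemma cluster_subsequence (V : normedModType R) (u : nat -> V) (p : V) :
    cluster (u @ \oo) p ->
  exists2 s : nat -> nat, (forall k, (k <= s k)%N) & u (s k) @[k --> \oo] --> p.
Proof.
move=> clu.
have /choice[s sP] k : exists n, (k <= n)%N /\ `|p - u n| < k.+1%:R^-1.
  have Bk : nbhs p (ball p k.+1%:R^-1) by apply: nbhsx_ballx; rewrite invr_gt0.
  have Ak : (u @ \oo) (u @` [set n | (k <= n)%N]) by exists k => // n/= kn; exists n.
  have [_ [[n/= kn <-] un]] := clu _ _ Ak Bk.
  by exists n; split => //; move: un; rewrite -ball_normE.
exists s => [k|]; first by have [] := sP k.
apply/cvgrPdist_lt => e e0; near=> k.
by apply: lt_trans (sP k).2 _; near: k; exact: near_infty_natSinv_lt (PosNum e0).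
Unshelve. all: by end_near. Qed.

Lemma leq_cvgn_infty (s : nat -> nat) : (forall k, (k <= s k)%N) -> s @ \oo --> \oo.
Proof.
by move=> ks A [N _ NA]; exists N => // k/= Nk; apply: NA; exact: leq_trans (ks k).
Qed.

Lemma bounded_cluster (H : finHilbertType R) (u : nat -> H) (r : R) :
  (forall n, `|u n| <= r) -> exists p, cluster (u @ \oo) p.
Proof.
move=> ur; have [K cK rK] := @closed_ball0_sub_compact _ H r.
have [|p [_ clu]] := cK (u @ \oo) _; last by exists p.
by exists 0%N => // n _; exact/rK/ur.
Qed.

End subsequences.

(** * Step sizes *)

Section stepsize.
Context {R : realType}.
Variables (alpha kappa ell theta eta gamma : R).

(** The decrease of the merit is [decrease_rate / (2 theta gamma eta)] times the
    squared increment of x.  For positive kappa, and when [1 <= eta] or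
    [ell = 0], it is the opposite of the polynomial in gamma whose roots are
    [gamma_lower] and [gamma_upper].  The absolute value comes from a term
    (eta - 1) <grad hbar x' - grad hbar x, x' - x>, where only the absolute
    value of the product is controlled. *)
Definition decrease_rate : R :=
  2 - eta + (eta * theta + 2 - 2 * theta) * alpha * gamma
  - (2 * `|eta - 1| + eta) * theta * ell * gamma
  - 2 * theta * kappa * (kappa + ell) * gamma ^+ 2.

Lemma quadratic_lt0_between (A b c t : R) : 0 < A ->
    (b - Num.sqrt (b ^+ 2 - 4 * A * c)) / (2 * A) < t
      < (b + Num.sqrt (b ^+ 2 - 4 * A * c)) / (2 * A) ->
  A * t ^+ 2 - b * t + c < 0.
Proof.
move=> A0; rewrite ltr_pdivrMr ?ltr_pdivlMr; [|lra|lra].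
set r := Num.sqrt _ => /andP[h1 h2].
have r0 : 0 < r by lra.
have r2 : r ^+ 2 = b ^+ 2 - 4 * A * c.
  by rewrite sqr_sqrtr// ltW// -sqrtr_gt0.
rewrite -(pmulr_rlt0 _ (_ : 0 < 4 * A)); last by lra.
have : 0 < (r - (2 * A * t - b)) * (r + (2 * A * t - b)) by apply: mulr_gt0; lra.
lra.
Qed.

Definition admissible_parameters : Prop :=
  [\/ [/\ 0 < kappa,
          ell = 0 -> 0 < eta < 2,
          0 < ell -> 1 <= eta < 2 &
          0 < gamma < gamma_upper alpha kappa ell theta eta],
      [/\ 0 < kappa,
          2 <= eta < 2 + 2 * kappa / (theta * (kappa + ell)),
          ((3 * eta - 2) * theta * ell
             + 2 * Num.sqrt (2 * (eta - 2) * theta * kappa * (kappa + ell)))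
            / (eta * theta + 2 - 2 * theta) < alpha &
          gamma_lower alpha kappa ell theta eta < gamma
            < gamma_upper alpha kappa ell theta eta] |
      [/\ kappa = 0,
          0 < eta < 2,
          0 < ell -> eta <= 1 -> gamma < 1 / (theta * ell) &
          0 < ell -> 1 < eta ->
            gamma < (2 - eta) / ((3 * eta - 2) * theta * ell)]].

Let decrease_rate_gt0_between_roots : 0 <= ell -> 0 < theta <= 1 ->
  0 < kappa -> (ell == 0) || (1 <= eta) ->
  gamma_lower alpha kappa ell theta eta < gamma
    < gamma_upper alpha kappa ell theta eta -> 0 < decrease_rate.
Proof.
move=> ell_ge0 /andP[th0 th1] k0 le1.
pose b := (eta * theta + 2 - 2 * theta) * alpha - (3 * eta - 2) * theta * ell.
have DE : Delta alpha kappa ell theta eta =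
    b ^+ 2 - 4 * (2 * theta * kappa * (kappa + ell)) * (eta - 2).
  by rewrite /Delta -/b; ring.
rewrite /gamma_lower /gamma_upper DE -/b.
have -> : 4 * theta * kappa * (kappa + ell) = 2 * (2 * theta * kappa * (kappa + ell)).
  by ring.
have A0 : 0 < 2 * theta * kappa * (kappa + ell).
  have kl0 : 0 < kappa + ell by rewrite ltr_pwDl.
  by rewrite !mulr_gt0.
move/(quadratic_lt0_between A0).
have -> : b = (eta * theta + 2 - 2 * theta) * alpha
   - (2 * `|eta - 1| + eta) * theta * ell.
  rewrite /b; case/orP: le1 => [/eqP->|le1]; first by rewrite !mulr0.
  by rewrite ger0_norm; [ring|lra].
by rewrite /decrease_rate; lra.
Qed.

(** When [eta < 2] the constant term of the polynomial is negative, so its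
    smaller root is negative and only the upper bound on gamma matters.  When
    [kappa = 0] the hypothesis on [alpha] says that it is nonnegative, and the
    rate is at least 2 - eta - (2 |eta - 1| + eta) theta ell gamma. *)
Lemma decrease_rate_gt0 : 0 <= ell -> - kappa <= alpha ->
    0 < gamma -> 0 < theta <= 1 -> 0 < eta ->
  admissible_parameters -> 0 < decrease_rate.
Proof.
move=> ell_ge0 alphaN gamma_gt0 theta01 eta_gt0.
have /andP[th0 th1] := theta01.
case=> [[k0 l0 l1 /andP[_ gu]]|[k0 /andP[e2 _] _ gu]|[k0 /andP[_ e2] h1 h2]].
- have [le1 e2] : (ell == 0) || (1 <= eta) /\ eta < 2.
    have [/eqP l|l] := eqVneq ell 0.
      by split=> //; have /andP[] := l0 (eqP l).
    have := l1; rewrite lt_neqAle eq_sym l ell_ge0 => /(_ isT)/andP[? ?].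
    by split => //; apply/orP; right.
  apply: decrease_rate_gt0_between_roots => //; rewrite gu andbT.
  apply: lt_trans gamma_gt0.
  have kl0 : 0 < kappa + ell by rewrite ltr_pwDl.
  have A0 : 0 < theta * kappa * (kappa + ell) by rewrite !mulr_gt0.
  have e2A0 : 0 < (2 - eta) * (theta * kappa * (kappa + ell)).
    by rewrite mulr_gt0// subr_gt0.
  rewrite /gamma_lower pmulr_llt0 ?invr_gt0; last by lra.
  pose b := (eta * theta + 2 - 2 * theta) * alpha - (3 * eta - 2) * theta * ell.
  rewrite /Delta -/b.
  rewrite subr_lt0 (le_lt_trans (ler_norm _))// -sqrtr_sqr ltr_sqrt.
    rewrite ltrBrDl gtrDr.
    by have := e2A0; lra.
  by have := sqr_ge0 b; lra.
- by apply: decrease_rate_gt0_between_roots; rewrite // (le_trans _ e2) ?orbT// ler1n.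
- have a0 : 0 <= alpha by lra.
  have : 0 <= (eta * theta + 2 - 2 * theta) * alpha * gamma.
    by rewrite !mulr_ge0// ?ltW//; have := mulr_gt0 eta_gt0 th0; lra.
  rewrite /decrease_rate k0.
  have [->|l] := eqVneq ell 0; first by lra.
  have lgt0 : 0 < ell by rewrite lt_neqAle eq_sym l.
  have tl0 : 0 < theta * ell by exact: mulr_gt0.
  have [e1|e1] := leP eta 1.
    have := h1 lgt0 e1; rewrite ltr_pdivlMr// => hg.
    rewrite ler0_norm; last by lra.
    have : 0 < (2 - eta) * (1 - gamma * (theta * ell)) by rewrite mulr_gt0//; lra.
    lra.
  have := h2 lgt0 e1; rewrite ltr_pdivlMr; last by rewrite !mulr_gt0//; lra.
  rewrite gtr0_norm; last by lra.
  lra.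
Qed.

(** With s = theta gamma (kappa + ell) and the bound [alpha <= kappa], the rate is
    at most (1 - s) (2 - eta + 2 kappa gamma) - 4 (eta - 1) theta ell gamma.  If
    [1 <= s] the second factor is nonnegative, by the upper bound on [eta] when
    [eta] exceeds 2, so the rate could not be positive. *)
Lemma theta_gamma_smoothness_lt1 : 0 <= ell -> - kappa <= alpha ->
    0 < gamma -> 0 < theta <= 1 -> 0 < eta ->
  admissible_parameters -> alpha <= kappa -> theta * gamma * (kappa + ell) < 1.
Proof.
move=> ell_ge0 alphaN gamma_gt0 theta01 eta_gt0 h ak.
have rate0 := decrease_rate_gt0 ell_ge0 alphaN gamma_gt0 theta01 eta_gt0 h.
have /andP[th0 th1] := theta01.
set s := theta * gamma * (kappa + ell).
rewrite ltNge; apply/negP => s1.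
have key : 0 < kappa -> (ell == 0) || (1 <= eta) ->
    0 <= 2 - eta + 2 * kappa * gamma -> False.
  move=> k0 le1 ge0.
  have rateE : decrease_rate =
    2 - eta + (eta * theta + 2 - 2 * theta) * alpha * gamma
      - (3 * eta - 2) * theta * ell * gamma - 2 * kappa * gamma * s.
    rewrite /decrease_rate /s; case/orP: le1 => [/eqP->|le1]; first by ring.
    by rewrite ger0_norm; [ring|lra].
  have h1 : 0 <= (eta * theta + 2 - 2 * theta) * gamma * (kappa - alpha).
    by rewrite !mulr_ge0//; have := mulr_gt0 eta_gt0 th0; lra.
  have h2 : 0 <= (eta - 1) * ell * theta * gamma.
    case/orP: le1 => [/eqP->|le1]; first by rewrite mulr0 !mul0r.
    by rewrite !mulr_ge0//; lra.
  have h3 : 0 <= (s - 1) * (2 - eta + 2 * kappa * gamma) by rewrite mulr_ge0//; lra.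
  move: rate0; rewrite rateE; apply/negP; rewrite -leNgt.
  by rewrite /s in h3 *; lra.
case: h => [[k0 l0 l1 /andP[_ gu]]|[k0 /andP[e2 e3] _ gu]|[k0 /andP[_ e2] h1 h2]].
- apply: key => //.
    have [l|l] := eqVneq ell 0; first by apply/orP; left; apply/eqP.
    have := l1; rewrite lt_neqAle eq_sym l ell_ge0 => /(_ isT)/andP[? ?].
    by apply/orP; right.
  have : eta < 2.
    have [/eqP l|l] := eqVneq ell 0; first by have /andP[] := l0 (eqP l).
    by have := l1; rewrite lt_neqAle eq_sym l ell_ge0 => /(_ isT)/andP[].
  by have := mulr_gt0 k0 gamma_gt0; lra.
- apply: key => //; first by rewrite (le_trans _ e2) ?orbT// ler1n.
  have tk0 : 0 < theta * (kappa + ell) by rewrite mulr_gt0//; lra.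
  have : 2 * kappa / (theta * (kappa + ell)) <= 2 * kappa * gamma.
    rewrite ler_pdivrMr//.
    have : 0 <= kappa * (s - 1) by apply: mulr_ge0; [exact: ltW|rewrite subr_ge0].
    by rewrite /s; lra.
  lra.
- have [l|l] := eqVneq ell 0; first by move: s1; rewrite /s k0 l addr0 mulr0; lra.
  have lgt0 : 0 < ell by rewrite lt_neqAle eq_sym l.
  have tl0 : 0 < theta * ell by exact: mulr_gt0.
  rewrite /s k0 add0r in s1; have [e1|e1] := leP eta 1.
    by have := h1 lgt0 e1; rewrite ltr_pdivlMr//; lra.
  have := h2 lgt0 e1; rewrite ltr_pdivlMr; last by rewrite !mulr_gt0//; lra.
  have : 0 <= (theta * gamma * ell - 1) * (3 * eta - 2) by rewrite mulr_ge0//; lra.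
  lra.
Qed.

End stepsize.

(** * Decrease of the surrogate *)

Section merit_decrease.
Context {R : realType} {H : finHilbertType R}.
Implicit Types (x y : H) (phi : H -> R).

Definition linearization phi (dphi : H -> H) x y : R :=
  phi x + inner (dphi x) (y - x).

Definition surrogate phi psi (dphi dpsi : H -> H) (c : R) x y : R :=
  linearization phi dphi x y + linearization psi dpsi x y + c * `|y - x| ^+ 2.

(** The scalar content of [merit_decrease]: a, s, t, m1, m2 stand for |d|^2, <D, d>,
    |D|^2, <E, d>, <E, D>, where d, D, E are the increments of x, of the gradient
    of phi and of the gradient of psi. *)
Let scalar_decrease (alpha kappa ell theta eta gamma a s t m1 m2 Df Dh : R) :
    0 < gamma -> 0 < theta <= 1 -> 0 < eta -> 0 <= a ->
    alpha * a <= s -> t <= kappa ^+ 2 * a -> `|m1| <= ell * a ->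
    m2 <= ell * kappa * a -> alpha / 2 * a <= Df -> Dh <= ell / 2 * a ->
  decrease_rate alpha kappa ell theta eta gamma / (2 * theta * gamma * eta) * a
  <= Df - (s + gamma * t) / eta - Dh + m1 - (m1 + gamma * m2) / eta
     + (2 * (theta * gamma))^-1 * (2 * ((a + gamma * s) / eta) - a).
Proof.
move=> g0 /andP[th0 th1] e0 a0 sa ta m1a m2a DfP DhP.
have D0 : 0 < 2 * theta * gamma * eta by rewrite !mulr_gt0.
rewrite mulrAC ler_pdivrMr//.
have -> : (Df - (s + gamma * t) / eta - Dh + m1 - (m1 + gamma * m2) / eta
     + (2 * (theta * gamma))^-1 * (2 * ((a + gamma * s) / eta) - a))
   * (2 * theta * gamma * eta) =
  2 * (theta * gamma * eta * Df) + 2 * (gamma * ((1 - theta) * s))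
  - 2 * (theta * gamma * gamma * t) - 2 * (theta * gamma * eta * Dh)
  + 2 * (theta * gamma * ((eta - 1) * m1)) - 2 * (theta * gamma * gamma * m2)
  + (2 - eta) * a.
  by field; rewrite !gt_eqF.
have tg : 0 < theta * gamma by exact: mulr_gt0.
have tge : 0 < theta * gamma * eta by exact: mulr_gt0.
have tgg : 0 < theta * gamma * gamma by exact: mulr_gt0.
have h1 := ler_wpM2l (ltW tge) DfP.
have h2 : gamma * ((1 - theta) * (alpha * a)) <= gamma * ((1 - theta) * s).
  by apply: ler_wpM2l; [exact: ltW|apply: ler_wpM2l => //; rewrite subr_ge0].
have h3 := ler_wpM2l (ltW tgg) ta.
have h4 := ler_wpM2l (ltW tge) DhP.
have h5 : theta * gamma * - (`|eta - 1| * (ell * a)) <= theta * gamma * ((eta - 1) * m1).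
  apply: ler_wpM2l; first exact: ltW.
  by rewrite lerNl (le_trans (ler_norm _))// normrN normrM ler_wpM2l.
have h6 := ler_wpM2l (ltW tgg) m2a.
move: h1 h2 h3 h4 h5 h6; rewrite /decrease_rate; move: `|eta - 1| => N.
lra.
Qed.

Let model_difference (p q D E e d : H) (r r' s s' c : R) :
  (r + inner p e + (s + inner q e) + c * `|e| ^+ 2)
  - (r' + inner (p + D) (e - d) + (s' + inner (q + E) (e - d)) + c * `|e - d| ^+ 2)
  = r - r' + inner (p + D) d - inner D e - (s' - s - inner q d) + inner E d
    - inner E e + c * (2 * inner e d - `|d| ^+ 2).
Proof.
have -> : `|e - d| ^+ 2 = `|e| ^+ 2 - 2 * inner e d + `|d| ^+ 2.
  by rewrite !sqr_normE innerDl !innerDr !innerNl !innerNr (innerC d e); ring.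
rewrite !(innerDl, innerDr, innerNr); ring.
Qed.

(** The difference contains the Bregman distances of phi and psi at x with base
    point x'.  That of phi is bounded below by strong convexity.  That of psi is
    rewritten as <E, d> minus the distance at x' with base point x, to which the
    smoothness of psi applies: the product <E, d> then carries the factor
    eta - 1, which vanishes at [eta = 1]. *)
Lemma merit_decrease (phi psi : H -> R)
    (alpha kappa ell theta eta gamma : R) x x' y :
    0 <= ell -> 0 < gamma -> 0 < theta <= 1 -> 0 < eta ->
    (forall u, differentiable phi u) -> kappa.-lipschitz (grad phi) ->
    alpha_convex alpha (EFin \o phi) ->
    (forall u, differentiable psi u) -> ell.-lipschitz (grad psi) ->
    eta *: (y - x) = (x' - x) + gamma *: (grad phi x' - grad phi x) ->
  decrease_rate alpha kappa ell theta eta gamma / (2 * theta * gamma * eta)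
    * `|x' - x| ^+ 2
  <= surrogate phi psi (grad phi) (grad psi) (2 * (theta * gamma))^-1 x y
     - surrogate phi psi (grad phi) (grad psi) (2 * (theta * gamma))^-1 x' y.
Proof.
move=> l0 g0 th01 e0 dphi Lphi cphi dpsi Lpsi yE.
have sum_le (p q i j r : R) :
    p + i + r <= q -> q + - (i + j) + r <= p -> 2 * r <= j by lra.
have sub_le (p q i r : R) : p + - i + r <= q -> r <= q - p + i by lra.
(* opaque names, so that rewriting does not look into the increments *)
have [d dE] : exists d, d = x' - x
  by exact: ex_intro erefl.
have [D DE] : exists D, D = grad phi x' - grad phi x
  by exact: ex_intro erefl.
have [E EE] : exists E, E = grad psi x' - grad psi x
  by exact: ex_intro erefl.
have Dd : `|D| <= kappa * `|d| by rewrite DE dE; exact: (lipschitz_setTP Lphi).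
have Ed : `|E| <= ell * `|d| by rewrite EE dE; exact: (lipschitz_setTP Lpsi).
have strong := alpha_convex_le dphi Lphi cphi.
have s1 := strong x x'; have s2 := strong x' x.
have /ler_normlP[_ desc] := descent_bound dpsi Lpsi x x'.
have xd : x - x' = - d by rewrite dE opprB.
rewrite xd normrN innerNr in s2; rewrite -dE in s1 desc.
have yx : y - x = eta^-1 *: (d + gamma *: D).
  by rewrite dE DE -yE scalerA mulVf ?scale1r// gt_eqF.
have yx' : y - x' = y - x - d by rewrite dE opprB addrA subrK.
have gphi : grad phi x' = grad phi x + D by rewrite DE addrC subrK.
have gpsi : grad psi x' = grad psi x + E by rewrite EE addrC subrK.
have := @scalar_decrease alpha kappa ell theta eta gamma
  (`|d| ^+ 2) (inner D d) (`|D| ^+ 2) (inner E d) (inner E D)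
  (phi x - phi x' + inner (grad phi x') d)
  (psi x' - psi x - inner (grad psi x) d).
move=> /(_ g0 th01 e0 (sqr_ge0 _)) => dec.
rewrite -dE; apply: (le_trans (dec _ _ _ _ _ _)) => {dec}.
- rewrite gphi innerDl in s2; have := sum_le _ _ _ _ _ s1 s2.
  by rewrite mulrA (mulrC 2) divfK ?pnatr_eq0.
- by rewrite -exprMn ler_pXn2r// nnegrE// (le_trans _ Dd).
- rewrite (le_trans (cauchy_schwarz _ _))// expr2 mulrA ler_wpM2r//.
- rewrite (le_trans (inner_le_norm _ _))//.
  have := ler_pM (normr_ge0 _) (normr_ge0 _) Ed Dd.
  by rewrite expr2 mulrACA.
- exact: sub_le s2.
- exact: desc.
have [e eE] : exists e, e = y - x by exact: ex_intro erefl.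
have de : inner e d = (`|d| ^+ 2 + gamma * inner D d) / eta.
  by rewrite eE yx sqr_normE innerZl innerDl innerZl mulrC.
have De : inner D e = (inner D d + gamma * `|D| ^+ 2) / eta.
  by rewrite eE yx sqr_normE innerZr innerDr innerZr mulrC.
have Ee : inner E e = (inner E d + gamma * inner E D) / eta.
  by rewrite eE yx innerZr innerDr innerZr mulrC.
rewrite /surrogate /linearization yx' gphi gpsi -eE model_difference de De Ee.
by rewrite mulrA.
Qed.

End merit_decrease.

(** * Convergence of the iterates *)

(** The iteration is seen through the optimality conditions of its steps.  The
    maps df and dh stand for the gradients of f and hbar, and L for the merit;
    keeping them abstract separates the convergence argument from the choice
    operator which defines [grad]. *)
Section convergence.
Context {R : realType} {H : finHilbertType R}.
Variables (f hbar hund : H -> R) (g : H -> \bar R) (df dh : H -> H).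
Variables (kappa ell gamma eta c sigma delta : R).
Variables (x y z ys : nat -> H) (L : nat -> \bar R).

Local Notation model n := (surrogate f hbar df dh c (x n.+1)).

Hypothesis kappa_ge0 : 0 <= kappa.
Hypotheses (gamma_gt0 : 0 < gamma) (eta_gt0 : 0 < eta).
Hypotheses (sigma_gt0 : 0 < sigma) (delta_gt0 : 0 < delta).
Hypothesis f_smooth : forall u v,
  `|f v - f u - inner (df u) (v - u)| <= kappa / 2 * `|v - u| ^+ 2.
Hypothesis h_smooth : forall u v,
  `|hbar v - hbar u - inner (dh u) (v - u)| <= ell / 2 * `|v - u| ^+ 2.
Hypothesis df_lip : forall u v, `|df u - df v| <= kappa * `|u - v|.
Hypothesis dh_lip : forall u v, `|dh u - dh v| <= ell * `|u - v|.
Hypotheses (f_cont : continuous f) (hbar_cont : continuous hbar).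
Hypothesis hund_cont : continuous hund.
Hypotheses (g_proper : proper_fun g) (g_lsc : lower_semicontinuous g).
Hypothesis F_coercive : coercive (objective f g hbar hund).
Hypothesis xP : forall n, z n = x n.+1 + gamma *: df (x n.+1).
Hypothesis yP : forall n,
  argmin (fun u => g u + (model n u - inner (ys n) u)%:E)%E (y n.+1).
Hypothesis zP : forall n, z n.+1 = z n + eta *: (y n.+1 - x n.+1).
Hypothesis ysP : forall n, convex_subdiff hund (y n) (ys n).
Hypothesis modelP : forall n, delta * `|x n.+2 - x n.+1| ^+ 2
  <= model n (y n.+1) - model n.+1 (y n.+1).
Hypothesis sigmaP : forall u : H,
  sigma * `|u| ^+ 2 <= (c - kappa / 2 - ell / 2) * `|u| ^+ 2.
Hypothesis meritP : forall n, L n.+1 = (g (y n.+1)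
  + (model n (y n.+1) - hund (y n) - inner (ys n) (y n.+1 - y n))%:E)%E.

Let p n : H := df (x n.+1) + dh (x n.+1) - ys n.
Let G n : R := fine (g (y n)).
(** The part of the objective of the second step that depends on u, without g. *)
Let Q n u : R := inner (p n) (u - x n.+1) + c * `|u - x n.+1| ^+ 2.
(** The real values of the merit and of the objective, with the index shifted by
    one because the first prox steps produce the iterates of index 1. *)
Let Lr n : R := model n (y n.+1) + G n.+1 - hund (y n)
  - inner (ys n) (y n.+1 - y n).
Let Fr n : R := f (y n.+1) + G n.+1 + hbar (y n.+1) - hund (y n.+1).

Let gE n : g (y n.+1) = (G n.+1)%:E.
Proof.
have [gNy [u gu]] := g_proper; rewrite /G fineK//.
have := le_lt_trans (yP n u) (lte_add_pinfty gu (ltry _)).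
by have := gNy (y n.+1); case: (g (y n.+1)).
Qed.

Let modelE n u : model n u =
  f (x n.+1) + hbar (x n.+1) + Q n u + inner (ys n) (u - x n.+1).
Proof.
rewrite /surrogate /linearization /Q /p !(innerDl, innerNl).
by move: (inner (df _) _) (inner (dh _) _) (inner (ys _) _) => i1 i2 i3; ring.
Qed.

Let proxG n u : ((G n.+1 + Q n (y n.+1) - Q n u)%:E <= g u)%E.
Proof.
have := yP n u; rewrite !modelE gE !innerDr !innerNr.
move: (inner _ _) (inner _ _) (inner _ _) (Q _ _) (Q _ _) => i j k q0 q1.
case: (g u) => [s| |]; last by [].
- by rewrite -!EFinD !lee_fin; lra.
- by move=> _; exact: leey.
Qed.

Let proxGr n m : G n.+1 + Q n (y n.+1) - Q n (y m.+1) <= G m.+1.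
Proof. by rewrite -lee_fin -gE; exact: proxG. Qed.

Let Lr_decrease n : Lr n.+1 + delta * `|x n.+2 - x n.+1| ^+ 2 <= Lr n.
Proof.
have num (d m g0 g1 h h' s q q' s1 s2 s3 k : R) : d <= m - (k + q' + s1) ->
    g1 + q - q' <= g0 -> h + s <= h' -> s2 - s3 = s1 ->
    k + q + s2 + g1 - h' - s3 + d <= m + g0 - h - s by lra.
rewrite /Lr (modelE n.+1).
apply: (num _ _ _ _ _ _ _ _ (Q n.+1 (y n.+1))
   (inner (ys n.+1) (y n.+1 - x n.+2))).
- by rewrite -modelE; exact: modelP.
- exact: proxGr.
- exact: (ysP n).
- by rewrite -innerNr -innerDr opprB addrC subrKA.
Qed.

Let Fr_le n : Fr n + sigma * `|y n.+1 - x n.+1| ^+ 2 <= Lr n.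
Proof.
have num (s a fx fy i hx hy j g0 h h' k : R) : `|fy - fx - i| <= kappa / 2 * a ->
    `|hy - hx - j| <= ell / 2 * a -> s * a <= (c - kappa / 2 - ell / 2) * a ->
    h + k <= h' ->
    fy + g0 + hy - h' + s * a <= (fx + i) + (hx + j) + c * a + g0 - h - k.
  by move=> /ler_normlP[_ ?] /ler_normlP[_ ?] ? ?; lra.
by apply: num; [exact: f_smooth|exact: h_smooth|exact: sigmaP|exact: (ysP n)].
Qed.

(** Together with [Fr_le], this makes the gap between merit and objective vanish
    with the steps, as the subgradients are bounded. *)
Let Lr_le n : Lr n <= Fr n + (kappa / 2 + ell / 2 + c) * `|y n.+1 - x n.+1| ^+ 2
  + inner (ys n.+1 - ys n) (y n.+1 - y n).
Proof.
have num (a fx fy i hx hy j g0 h h' k k' : R) : `|fy - fx - i| <= kappa / 2 * a ->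
    `|hy - hx - j| <= ell / 2 * a -> h' - k' <= h ->
    (fx + i) + (hx + j) + c * a + g0 - h - k <=
    fy + g0 + hy - h' + (kappa / 2 + ell / 2 + c) * a + (k' - k).
  by move=> /ler_normlP[? _] /ler_normlP[? _] ?; lra.
rewrite innerDl innerNl; apply: num; [exact: f_smooth|exact: h_smooth|].
by have := ysP n.+1 (y n); rewrite -opprB innerNr.
Qed.

Let Lr_nincr n m : (n <= m)%N -> Lr m <= Lr n.
Proof.
move: n m; apply/nonincreasing_seqP => n; apply: le_trans (Lr_decrease n).
by rewrite lerDl mulr_ge0// ltW.
Qed.

Let Fr_Lr0 n : Fr n <= Lr 0.
Proof.
apply: le_trans (Lr_nincr (leq0n n)); apply: le_trans (Fr_le n).
by rewrite lerDl mulr_ge0// ltW.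
Qed.

Let FE n : objective f g hbar hund (y n.+1) = (Fr n)%:E.
Proof. by rewrite /objective gE -!EFinD /Fr addrA. Qed.

Let LE n : L n.+1 = (Lr n)%:E.
Proof. by rewrite meritP gE -EFinD; congr EFin; rewrite /Lr; ring. Qed.

Let y_bounded : exists M, forall n, `|y n| <= M.
Proof.
have [M MP] := F_coercive (Lr 0).
exists (Num.max M `|y 0%N|) => -[|n]; first by rewrite le_max lexx orbT.
rewrite le_max leNgt; case: ltP => //= /MP.
by rewrite FE lte_fin ltNge Fr_Lr0.
Qed.

(** The prox inequality of a single step already bounds g from below by a
    continuous function, hence on bounded sets. *)
Let Fr_lbound : exists m, forall n, m <= Fr n.
Proof.
have [M yM] := y_bounded.
have [|C CP] := @continuous_bounded_ball0 _ H
    (fun u => f u + hbar u - hund u - Q 0 u) _ M.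
  move=> u; have idu : continuous (fun v : H => v - x 1%N).
    by move=> v; apply: cvgB; [exact: cvg_id|exact: cvg_cst].
  apply: cvgB.
    by apply: cvgB; [apply: cvgD; [exact: f_cont|exact: hbar_cont]|
                     exact: hund_cont].
  apply: cvgD; first by apply: inner_cvg; [exact: cvg_cst|exact: idu].
  apply: cvgMl_tmp; under eq_fun do rewrite expr2.
  by rewrite expr2; apply: cvgM; apply: cvg_norm; exact: idu.
exists (G 1 + Q 0 (y 1%N) - C) => n.
have num (q0 q f0 h0 u0 g0 g1 : R) : `|f0 + h0 - u0 - q| <= C -> g0 + q0 - q <= g1 ->
    g0 + q0 - C <= f0 + g1 + h0 - u0.
  by move=> /ler_normlP[? _] ?; lra.
by apply: num; [exact: CP|exact: proxGr].
Qed.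

Let ys_bounded : exists B, forall n, `|ys n| <= B.
Proof.
have [M yM] := y_bounded.
have [C CP] := continuous_bounded_ball0 hund_cont (M + 1).
exists (C - (- C)) => n; apply: (subgradient_norm_le (ysP n)) => u un.
rewrite -ler_norml; apply: CP.
by rewrite -(subrK (y n) u) (le_trans (ler_normD _ _))// addrC lerD.
Qed.

Let yx_bounded : exists B, forall n, `|y n.+1 - x n.+1| <= B.
Proof.
have [m mP] := Fr_lbound.
have num (t k : R) : 0 <= t -> t ^+ 2 <= k -> t <= k + 1.
  move=> t0 tk; have := sqr_ge0 (t - 1); lra.
exists ((Lr 0 - m) / sigma + 1) => n; apply: num => //.
rewrite ler_pdivlMr// mulrC lerBrDl (le_trans _ (Lr_nincr (leq0n n)))//.
by apply: le_trans (Fr_le n); rewrite lerD2r.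
Qed.

Let x_bounded : exists B, forall n, `|x n.+1| <= B.
Proof.
have [M yM] := y_bounded; have [B BP] := yx_bounded.
exists (M + B) => n; rewrite -[x _](subKr (y n.+1)).
by rewrite (le_trans (ler_normB _ _))// lerD.
Qed.

Let z_bounded : exists B, forall n, `|z n.+1| <= B.
Proof.
have [X xX] := x_bounded; have [B BP] := yx_bounded.
exists (X + gamma * (kappa * X + `|df 0|) + eta * B) => n; rewrite zP xP.
have dfB : `|df (x n.+1)| <= kappa * X + `|df 0|.
  rewrite -(subrK (df 0) (df (x n.+1))); apply: le_trans (ler_normD _ _) _.
  rewrite lerD2r; apply: le_trans (df_lip _ _) _.
  by rewrite subr0; exact: ler_wpM2l.
apply: le_trans (ler_normD _ _) _; apply: lerD.
  apply: le_trans (ler_normD _ _) _; apply: lerD => //.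
  by rewrite normrZ gtr0_norm//; apply: ler_wpM2l; first exact: ltW.
by rewrite normrZ gtr0_norm//; apply: ler_wpM2l; first exact: ltW.
Qed.

(** The increments of x, which control all the steps. *)
Let d n : R := `|x n.+2 - x n.+1|.

Let z_step n : `|z n.+1 - z n| <= (1 + gamma * kappa) * d n.
Proof.
have -> : z n.+1 - z n = (x n.+2 - x n.+1) + gamma *: (df (x n.+2) - df (x n.+1)).
  by rewrite !xP scalerBr opprD addrACA.
rewrite mulrDl mul1r; apply: le_trans (ler_normD _ _) _; apply: lerD => //.
rewrite normrZ gtr0_norm// -mulrA; apply: ler_wpM2l; first exact: ltW.
exact: df_lip.
Qed.

Let yx_step n : `|y n.+1 - x n.+1| <= (1 + gamma * kappa) / eta * d n.
Proof.
rewrite mulrAC ler_pdivlMr//; apply: le_trans (z_step n).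
have -> : z n.+1 - z n = eta *: (y n.+1 - x n.+1) by rewrite zP addrAC subrr add0r.
by rewrite normrZ gtr0_norm// mulrC.
Qed.

Let K : R := 1 + gamma * kappa + (1 + gamma * kappa) / eta.

Let d_ge0 n : 0 <= d n. Proof. exact: normr_ge0. Qed.

Let steps_le n : [/\ `|x n.+2 - x n.+1| <= K * (d n + d n.+1),
  `|y n.+2 - y n.+1| <= K * (d n + d n.+1) &
  `|z n.+2 - z n.+1| <= K * (d n + d n.+1)].
Proof.
have gk0 : 0 <= gamma * kappa by rewrite mulr_ge0// ltW.
have k0 : 0 <= (1 + gamma * kappa) / eta.
  by rewrite divr_ge0// ?ltW// ltr_pwDl.
have K1 : 1 <= K by rewrite /K -addrA lerDl addr_ge0.
have K2 : 1 + gamma * kappa <= K by rewrite /K lerDl.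
have K3 : 1 + (1 + gamma * kappa) / eta <= K by rewrite /K lerD2r lerDl.
have d0 := d_ge0 n; have d1 := d_ge0 n.+1.
split.
- rewrite -/(d n) mulrDr -[leLHS]addr0; apply: lerD; last first.
    by rewrite mulr_ge0// (le_trans _ K1).
  by rewrite -[leLHS]mul1r ler_wpM2r.
- have -> : y n.+2 - y n.+1 = (y n.+2 - x n.+2) + (x n.+2 - x n.+1)
      - (y n.+1 - x n.+1).
    by rewrite subrKA opprB subrKA.
  apply: le_trans (ler_normB _ _) _.
  have h : `|y n.+2 - x n.+2 + (x n.+2 - x n.+1)|
      <= (1 + gamma * kappa) / eta * d n.+1 + d n.
    by apply: le_trans (ler_normD _ _) _; apply: lerD => //; exact: yx_step.
  apply: le_trans (lerD h (yx_step n)) _.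
  have h1 := ler_wpM2r d0 K3.
  have h2 : (1 + gamma * kappa) / eta * d n.+1 <= K * d n.+1.
    by apply: ler_wpM2r => //; rewrite (le_trans _ K3)// lerDr.
  by move: h1 h2; move: (_ / _) => k h1 h2; lra.
- apply: le_trans (z_step n.+1) _; apply: ler_pM => //.
    by rewrite addr_ge0.
  by rewrite lerDr.
Qed.

(** Squared steps are controlled by two consecutive decreases of the merit, that
    is, by one decrease of the sum of two consecutive merits. *)
Let T n : R := Lr n + Lr n.+1.

Let hnorm3_step n :
  hnorm3 ((x n.+2, y n.+2, z n.+2) - (x n.+1, y n.+1, z n.+1)) ^+ 2
  <= 6 * K ^+ 2 / delta * (T n - T n.+1).
Proof.
have [hx hy hz] := steps_le n.
rewrite sqr_sqrtr ?addr_ge0//=.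
have num (a b e k d0 d1 l0 l1 l2 : R) : 0 <= a -> 0 <= b -> 0 <= e ->
    a <= k * (d0 + d1) -> b <= k * (d0 + d1) -> e <= k * (d0 + d1) ->
    l1 + delta * d0 ^+ 2 <= l0 -> l2 + delta * d1 ^+ 2 <= l1 ->
    a ^+ 2 + b ^+ 2 + e ^+ 2 <= 6 * k ^+ 2 / delta * (l0 + l1 - (l1 + l2)).
  move=> a0 b0 e0 ak bk ek h1 h2.
  have sq (t : R) : 0 <= t -> t <= k * (d0 + d1) -> t ^+ 2 <= k ^+ 2 * (d0 + d1) ^+ 2.
    by move=> t0 tk; rewrite -exprMn ler_pXn2r// nnegrE (le_trans t0).
  apply: (@le_trans _ _ (3 * k ^+ 2 * (d0 + d1) ^+ 2)).
    by have := sq _ a0 ak; have := sq _ b0 bk; have := sq _ e0 ek; lra.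
  rewrite [leRHS]mulrAC ler_pdivlMr//.
  have : 0 <= k ^+ 2 * (l0 + l1 - (l1 + l2) - delta * d0 ^+ 2 - delta * d1 ^+ 2).
    by apply: mulr_ge0; [exact: sqr_ge0|lra].
  have : 0 <= k ^+ 2 * (delta * (d0 - d1) ^+ 2).
    by apply: mulr_ge0; [exact: sqr_ge0|apply: mulr_ge0; [exact: ltW|exact: sqr_ge0]].
  lra.
apply: (num _ _ _ K (d n) (d n.+1) (Lr n) (Lr n.+1) (Lr n.+2)) => //;
  exact: Lr_decrease.
Qed.

Let Lr_cvg : exists l : R, Lr n @[n --> \oo] --> l.
Proof.
have [m mP] := Fr_lbound.
suff /cvg_ex[l Ll] : cvgn Lr by exists l.
apply: nonincreasing_is_cvgn => [n n' /Lr_nincr//|].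
exists m => _ [n _ <-]; apply: le_trans (mP n) _; apply: le_trans (Fr_le n).
by rewrite lerDl mulr_ge0// ltW.
Qed.

Let d_cvg0 : d n @[n --> \oo] --> (0 : R).
Proof.
have [l Ll] := Lr_cvg.
have dif : Lr n - Lr n.+1 @[n --> \oo] --> (0 : R).
  by rewrite -(subrr l); apply: cvgB => //; rewrite cvg_shiftS.
apply/cvgrPdist_lt => e e0; near=> n.
rewrite sub0r normrN ger0_norm//.
rewrite -(ltr_pXn2r (n:=2))// ?nnegrE// ?ltW//.
rewrite -(ltr_pM2l delta_gt0).
have : Lr n - Lr n.+1 < delta * e ^+ 2.
  by near: n; apply: (cvgr_lt 0) => //; rewrite mulr_gt0// exprn_gt0.
apply: le_lt_trans; rewrite lerBrDl; exact: Lr_decrease.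
Unshelve. all: by end_near. Qed.

Let cvg0_of_steps (V : normedModType R) (u : nat -> V) (k : R) :
  (forall n, `|u n| <= k * (d n + d n.+1)) -> u n @[n --> \oo] --> (0 : V).
Proof.
move=> uk; apply/norm_cvg0P.
apply: (@squeeze_cvgr _ _ _ _ (cst 0) (fun n => k * (d n + d n.+1))).
- by near=> n; rewrite normr_ge0 uk.
- exact: cvg_cst.
- rewrite -(mulr0 k) -[X in k * X](addr0 0).
  apply: cvgMl_tmp; apply: cvgD; first exact: d_cvg0.
  by have := d_cvg0; rewrite -cvg_shiftS.
Unshelve. all: by end_near. Qed.

Let y_step_cvg0 : y n.+1 - y n @[n --> \oo] --> (0 : H).
Proof.
rewrite -(cvg_shiftS (fun n => y n.+1 - y n)); apply: (@cvg0_of_steps _ _ K) => n.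
by have [] := steps_le n.
Qed.

Let yx_cvg0 : y n.+1 - x n.+1 @[n --> \oo] --> (0 : H).
Proof.
apply: (@cvg0_of_steps _ _ ((1 + gamma * kappa) / eta)) => n.
apply: le_trans (yx_step n) _; apply: ler_wpM2l; last by rewrite lerDl.
by rewrite divr_ge0// ?ltW// ltr_pwDl// mulr_ge0// ltW.
Qed.

Lemma iterates_bounded :
  bounded_fun (fun n => (x n.+1, y n.+1, z n.+1, ys n) : H * H * H * H).
Proof.
have [X xX] := x_bounded; have [Y yY] := y_bounded.
have [Z zZ] := z_bounded; have [B ysB] := ys_bounded.
exists (Num.max (Num.max (Num.max X Y) Z) B); split; first exact: num_real.
move=> M; rewrite !gt_max => /andP[/andP[/andP[XM YM] ZM] BM] n _ /=.
rewrite !ge_max (le_trans (xX n) (ltW XM)) (le_trans (yY n.+1) (ltW YM)).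
by rewrite (le_trans (zZ n) (ltW ZM)) (le_trans (ysB n) (ltW BM)).
Qed.

Lemma steps_square_summable (w := fun n => (x n, y n, z n) : H * H * H) :
  (\sum_(1 <= n <oo) (hnorm3 (w n.+1 - w n) ^+ 2)%:E < +oo)%E.
Proof.
have [m mP] := Fr_lbound.
have mL n : m <= Lr n.
  apply: le_trans (mP n) _; apply: le_trans (Fr_le n).
  by rewrite lerDl mulr_ge0// ltW.
pose E := 6 * K ^+ 2 / delta.
have E0 : 0 <= E.
  by apply: divr_ge0; [apply: mulr_ge0 => //; exact: sqr_ge0|exact: ltW].
have partial N : \sum_(1 <= n < N.+1) hnorm3 (w n.+1 - w n) ^+ 2 <= E * (T 0 - T N).
  elim: N => [|N IHN]; first by rewrite big_geq// subrr mulr0.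
  rewrite big_nat_recr//=; apply: le_trans (lerD IHN (hnorm3_step N)) _.
  by rewrite -/E -mulrDr subrKA.
apply: (@le_lt_trans _ _ (E * (T 0 - (m + m)))%:E); last exact: ltry.
apply: lime_le.
  by apply: is_cvg_nneseries => n _ _; rewrite lee_fin sqr_ge0.
near=> N; rewrite sumEFin lee_fin.
have /prednK <- : (0 < N)%N by near: N; exact: nbhs_infty_gt.
apply: le_trans (partial _) _; rewrite ler_wpM2l// lerB// lerD//.
Unshelve. all: by end_near. Qed.

Lemma steps_cvg0 (w := fun n => (x n, y n, z n) : H * H * H) :
  w n.+1 - w n @[n --> \oo] --> (0 : H * H * H).
Proof.
rewrite -(cvg_shiftS (fun n => w n.+1 - w n)).
apply: (@cvg0_of_steps (H * H * H)%type _ K) => n.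
have [hx hy hz] := steps_le n.
by rewrite /= !ge_max hx hy hz.
Qed.

Let merit_gap_cvg0 : Lr n - Fr n @[n --> \oo] --> (0 : R).
Proof.
have [B ysB] := ys_bounded.
pose C := kappa / 2 + ell / 2 + c.
apply: (@squeeze_cvgr _ _ _ _ (cst 0)
  (fun n => C * `|y n.+1 - x n.+1| ^+ 2 + (B + B) * `|y n.+1 - y n|)).
- near=> n; apply/andP; split.
    rewrite subr_ge0; apply: le_trans (Fr_le n).
    by rewrite lerDl mulr_ge0// ltW.
  rewrite lerBlDl; apply: le_trans (Lr_le n) _.
  rewrite addrA lerD2l; apply: le_trans (inner_le_norm _ _) _.
  apply: ler_wpM2r => //; apply: le_trans (ler_normB _ _) _.
  exact: lerD.
- exact: cvg_cst.
- rewrite -[X in _ --> X](addr0 0); apply: cvgD.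
    rewrite -(mulr0 C) -[X in C * X](mulr0 0); apply: cvgMl_tmp.
    under eq_fun do rewrite expr2.
    by apply: cvgM; apply/norm_cvg0P; exact: yx_cvg0.
  rewrite -(mulr0 (B + B)); apply: cvgMl_tmp.
  by apply/norm_cvg0P; exact: y_step_cvg0.
Unshelve. all: by end_near. Qed.

Let lipschitz_cvg (W : H -> H) (k : R) (u : nat -> H) (a : H) :
    (forall p q, `|W p - W q| <= k * `|p - q|) ->
  u n @[n --> \oo] --> a -> W (u n) @[n --> \oo] --> W a.
Proof.
move=> Wk ua; apply/subr_cvg0/norm_cvg0P.
apply: (@squeeze_cvgr _ _ _ _ (cst 0) (fun n => k * `|u n - a|)).
- by near=> n; rewrite normr_ge0 Wk.
- exact: cvg_cst.
- rewrite -(mulr0 k); apply: cvgMl_tmp.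
  by apply/norm_cvg0P/subr_cvg0.
Unshelve. all: by end_near. Qed.

(** Fermat's rule for the second step: the minimality of y_{n+1} gives g a concave
    quadratic minorant which touches it there, and the smoothness of f and hbar
    provides one for each of them with slope df or dh; the slopes add up. *)
Let regular_subgradient n :
  regular_subdiff (fun u => (f u)%:E + g u + (hbar u)%:E)%E (y n.+1)
    (df (y n.+1) + dh (y n.+1) - p n - (2 * c) *: (y n.+1 - x n.+1)).
Proof.
apply: (@quadratic_minorant_regular_subdiff _ _ _ _ _ (kappa / 2 + ell / 2 + c)).
  by rewrite gE -!EFinD.
move=> u; rewrite gE -!EFinD.
have num (fu fy hu hy g0 q0 q1 i j k a r s: R) (gu : \bar R) :
    `|fu - fy - i| <= kappa / 2 * a -> `|hu - hy - j| <= ell / 2 * a ->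
    q1 = q0 + k + c * (2 * r + a) ->
    ((g0 + q0 - q1)%:E <= gu)%E ->
    ((fy + g0 + hy + (i + j - k - 2 * c * r - (kappa / 2 + ell / 2 + c) * a))%:E
      <= fu%:E + gu + hu%:E)%E.
  move=> /ler_normlP[h1 _] /ler_normlP[h2 _] q1E.
  case: gu => [w| |]; last by [].
  - by rewrite q1E -!EFinD !lee_fin => h3; lra.
  - by move=> _; rewrite addey// addye// leey.
have expand (a b q e w : H) : inner (a + b - q - (2 * c) *: e) w =
    inner a w + inner b w - inner q w - 2 * c * inner e w.
  by rewrite !(innerDl, innerNl, innerZl).
rewrite expand; apply: (num _ _ _ _ _ (Q n (y n.+1)) (Q n u) _ _ _ _ _ 0) => //.
rewrite /Q.
have -> : u - x n.+1 = (y n.+1 - x n.+1) + (u - y n.+1) by rewrite [RHS]addrC subrKA.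
move: (y n.+1 - x n.+1) (u - y n.+1) (p n) => a b q.
rewrite !sqr_normE innerDr innerDl !innerDr (innerC b a).
by move: (inner _ _) (inner _ _) (inner _ _) (inner _ _) (inner _ _) => *; ring.
Qed.

Let g_lsc_le (u : nat -> H) (ub : H) (a : nat -> R) (b : R) :
    (forall n, g (u n) = (a n)%:E) -> u n @[n --> \oo] --> ub ->
    a n @[n --> \oo] --> b ->
  (g ub <= b%:E)%E.
Proof.
move=> ga uub ab; rewrite leNgt; apply/negP => bg.
have [e be eg] : exists2 e : R, b < e & (e%:E < g ub)%E.
  case: (g ub) bg => [s| |//].
  - rewrite lte_fin => bs; exists ((b + s) / 2); rewrite ?lte_fin; lra.
  - by move=> _; exists (b + 1); [rewrite ltrDl|exact: ltry].
have [V Vub Ve] := g_lsc eg.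
near \oo => n.
have : e < a n by rewrite -lte_fin -ga; apply: Ve; near: n; exact: uub.
by apply/negP; rewrite -leNgt; near: n; exact: (cvgr_le b).
Unshelve. all: by end_near. Qed.

(** The two subsequence extractions are needed because the cluster point does not
    see the subgradients ys, whose limit v is the common subgradient. *)
Lemma cluster_point_critical (xb yb zb : H) :
    cluster ((x n.+1, y n.+1, z n.+1) @[n --> \oo]) (xb, yb, zb) ->
  [/\ xb = yb,
      L n @[n --> \oo] --> objective f g hbar hund yb,
      objective f g hbar hund (y n) @[n --> \oo] --> objective f g hbar hund yb &
      exists2 v, convex_subdiff hund yb v &
        limiting_subdiff (fun u => (f u)%:E + g u + (hbar u)%:E)%E yb v].
Proof.
move=> /(@cluster_subsequence _ (H * H * H)%type)[s sk sP].
have [B ysB] := ys_bounded.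
have [v /cluster_subsequence[t tk tP]] :=
  @bounded_cluster R H (fun k => ys (s k)) B (fun k => ysB _).
pose r k := s (t k).
have r_oo : r @ \oo --> \oo.
  by apply: leq_cvgn_infty => k; exact: leq_trans (tk k) (sk _).
have t_oo : t @ \oo --> \oo by exact: leq_cvgn_infty.
have wP : (x (r k).+1, y (r k).+1, z (r k).+1) @[k --> \oo] --> (xb, yb, zb).
  exact: (cvg_comp _ _ t_oo sP).
have xyP : (x (r k).+1, y (r k).+1) @[k --> \oo] --> (xb, yb).
  exact: (cvg_comp _ _ wP (@cvg_fst _ _ _ _ _)).
have xP' : x (r k).+1 @[k --> \oo] --> xb.
  exact: (cvg_comp _ _ xyP (@cvg_fst _ _ _ _ _)).
have yP' : y (r k).+1 @[k --> \oo] --> yb.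
  exact: (cvg_comp _ _ xyP (@cvg_snd _ _ _ _ _)).
have ysP' : ys (r k) @[k --> \oo] --> v by exact: tP.
have yx0 : y (r k).+1 - x (r k).+1 @[k --> \oo] --> (0 : H).
  exact: (cvg_comp _ _ r_oo yx_cvg0).
have xyb : xb = yb.
  apply/eqP; rewrite eq_sym -subr_eq0; apply/eqP.
  exact: (norm_cvg_unique (cvgB yP' xP') yx0).
rewrite xyb in xP' *.
(* the subgradient of index r k is taken at y (r k), one step before *)
have y_prev : y (r k) @[k --> \oo] --> yb.
  have : y (r k).+1 - (y (r k).+1 - y (r k)) @[k --> \oo] --> yb - 0.
    by apply: cvgB => //; exact: (cvg_comp _ _ r_oo y_step_cvg0).
  by rewrite subr0; under eq_fun do rewrite subKr.
have [l Lrl] := Lr_cvg.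
have Frl : Fr n @[n --> \oo] --> l.
  have : Lr n - (Lr n - Fr n) @[n --> \oo] --> l - 0.
    by apply: cvgB => //; exact: merit_gap_cvg0.
  by rewrite subr0; under eq_fun do rewrite subKr.
have fP : f (y (r k).+1) @[k --> \oo] --> f yb.
  by apply: (cvg_comp _ _ yP'); exact: f_cont.
have hbarP : hbar (y (r k).+1) @[k --> \oo] --> hbar yb.
  by apply: (cvg_comp _ _ yP'); exact: hbar_cont.
have hundP : hund (y (r k).+1) @[k --> \oo] --> hund yb.
  by apply: (cvg_comp _ _ yP'); exact: hund_cont.
pose gl := l - (f yb + hbar yb - hund yb).
have Ggl : G (r k).+1 @[k --> \oo] --> gl.
  have GE n : G n.+1 = Fr n - (f (y n.+1) + hbar (y n.+1) - hund (y n.+1)).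
    by rewrite /Fr; ring.
  under eq_fun do rewrite GE.
  by apply: cvgB; [exact: (cvg_comp _ _ r_oo Frl)|exact: (cvgB (cvgD fP hbarP) hundP)].
have p_cvg : p (r k) @[k --> \oo] --> df yb + dh yb - v.
  apply: cvgB => //; apply: cvgD.
    exact: (lipschitz_cvg df_lip).
  exact: (lipschitz_cvg dh_lip).
have Q0 (u : nat -> H) : u k @[k --> \oo] --> yb -> Q (r k) (u k) @[k --> \oo] --> (0 : R).
  move=> uyb.
  have u0 : u k - x (r k).+1 @[k --> \oo] --> (0 : H).
    by rewrite -(subrr yb); exact: cvgB.
  rewrite -[X in _ --> X](addr0 0); apply: cvgD.
    by rewrite -(inner0r (df yb + dh yb - v)); exact: inner_cvg.
  rewrite -(mulr0 c) -[X in c * X](mulr0 0); apply: cvgMl_tmp.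
  under eq_fun do rewrite expr2.
  by apply: cvgM; apply/norm_cvg0P.
(* lower semicontinuity, then comparison of the minimizers with yb *)
have g_le : (g yb <= gl%:E)%E by exact: (g_lsc_le (fun k => gE (r k)) yP' Ggl).
have gyb : g yb = gl%:E.
  have [gNy _] := g_proper.
  case E : (g yb) g_le (gNy yb) => [w| |]//; rewrite lee_fin => wgl _.
  congr EFin; apply/eqP; rewrite eq_le wgl/=.
  have lim : G (r k).+1 + Q (r k) (y (r k).+1) - Q (r k) yb @[k --> \oo]
      --> gl + 0 - 0.
    by apply: cvgB; [apply: cvgD => //; exact: Q0|apply: Q0; exact: cvg_cst].
  rewrite addr0 subr0 in lim; apply: (cvgr_to_le lim).
  by near=> k; rewrite -lee_fin -E; exact: proxG.
have Fyb : objective f g hbar hund yb = l%:E.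
  by rewrite /objective gyb -!EFinD /gl; congr EFin; ring.
split => //.
- rewrite Fyb -cvg_shiftS; under eq_fun do rewrite LE.
  by apply: cvg_EFin => //; near=> n.
- rewrite Fyb -cvg_shiftS; under eq_fun do rewrite FE.
  by apply: cvg_EFin => //; near=> n.
exists v.
  move=> u.
  have lim : hund (y (r k)) + inner (ys (r k)) (u - y (r k)) @[k --> \oo]
      --> hund yb + inner v (u - yb).
    apply: cvgD; first by apply: (cvg_comp _ _ y_prev); exact: hund_cont.
    by apply: inner_cvg => //; apply: cvgB => //; exact: cvg_cst.
  apply: (cvgr_to_le lim).
  by near=> k; exact: ysP.
split; first by rewrite /dom/= gyb -!EFinD ltry.
exists (fun k => y (r k).+1); eexists; split.
- exact: yP'.
- by move=> k; exact: regular_subgradient.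
- under eq_fun do rewrite gE -!EFinD.
  rewrite gyb -!EFinD; apply: cvg_EFin; first by near=> k.
  exact: (cvgD (cvgD fP Ggl) hbarP).
- have -> : v = df yb + dh yb - (df yb + dh yb - v) - (2 * c) *: 0.
    by rewrite scaler0 subr0 subKr.
  apply: cvgB; last exact: cvgZl_tmp.
  apply: cvgB => //.
  by apply: cvgD; [exact: (lipschitz_cvg df_lip)|exact: (lipschitz_cvg dh_lip)].
Unshelve. all: by end_near. Qed.

End convergence.

(** * The prox steps of the algorithm *)

Section algorithm.
Context {R : realType} {H : finHilbertType R}.
Implicit Types (g : H -> \bar R) (phi psi : H -> R).

Lemma argmin_add_cst g (A B : H -> R) (k : R) y : (forall u, A u = B u + k) ->
  argmin (fun u => g u + (A u)%:E)%E y -> argmin (fun u => g u + (B u)%:E)%E y.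
Proof.
by move=> AB ymin u; have := ymin u; rewrite !AB !EFinD !addeA leeD2rE.
Qed.

(** Completing the square: the two objectives differ by tau / 2 |q|^2. *)
Lemma prox_gradient_step g (tau : R) (a q y : H) : 0 < tau ->
    prox tau g (a - tau *: q) y ->
  argmin (fun u => g u + (inner q (u - a) + (2 * tau)^-1 * `|u - a| ^+ 2)%:E)%E y.
Proof.
move=> tau0; apply: (@argmin_add_cst _ _ _ (tau / 2 * inner q q)) => u.
have -> : u - (a - tau *: q) = (u - a) + tau *: q by rewrite opprB addrCA addrC.
move: (u - a) => v; rewrite !sqr_normE.
have -> : inner (v + tau *: q) (v + tau *: q) =
    inner v v + 2 * tau * inner q v + tau ^+ 2 * inner q q.
  by rewrite innerDl !innerDr !innerZl !innerZr (innerC v q); ring.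
by move: (inner _ _) (inner _ _) (inner _ _) => i j k; field; rewrite gt_eqF.
Qed.

(** The extrapolation (theta + 1) x - theta z is x - theta gamma grad phi(x), so the
    prox step is a gradient step for the linearized objective. *)
Lemma argmin_surrogate g phi psi (theta gamma : R) (x y z s : H) :
    0 < gamma -> 0 < theta -> z = x + gamma *: grad phi x ->
    prox (theta * gamma) g
      ((theta + 1) *: x - theta *: z - (theta * gamma) *: grad psi x
         + (theta * gamma) *: s) y ->
  argmin (fun u => g u + (surrogate phi psi (grad phi) (grad psi)
    (2 * (theta * gamma))^-1 x u - inner s u)%:E)%E y.
Proof.
move=> gamma0 theta0 zE.
rewrite /surrogate /linearization.
move: (grad phi x) (grad psi x) zE => p q zE.
have -> : (theta + 1) *: x - theta *: z - (theta * gamma) *: q + (theta * gamma) *: s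
    = x - (theta * gamma) *: (p + q - s).
  rewrite zE scalerDr scalerA scalerDl scale1r opprD addrACA subrr add0r.
  by rewrite scalerBr scalerDr !opprD opprK !addrA.
move=> /prox_gradient_step => /(_ (mulr_gt0 theta0 gamma0)).
apply: (@argmin_add_cst _ _ _ (inner s x - phi x - psi x)) => u.
have -> : inner (p + q - s) (u - x) =
    inner p (u - x) + inner q (u - x) - (inner s u - inner s x).
  by rewrite innerDl innerDl innerNl [inner s _]innerDr innerNr.
by ring.
Qed.

(** Only the zero space admits a modulus of convexity larger than kappa. *)
Lemma convexity_modulus_le (alpha kappa : R) phi (u : H) : u != 0 ->
    (forall v, differentiable phi v) -> kappa.-lipschitz (grad phi) ->
  alpha_convex alpha (EFin \o phi) -> alpha <= kappa.
Proof.
move=> u0 dphi Lphi cphi.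
have strong := alpha_convex_le dphi Lphi cphi.
have num (r r' s s' a b : R) : r + s + alpha / 2 * a <= r' ->
    r' - s' + alpha / 2 * a <= r -> s' - s <= kappa * a -> 0 < a -> alpha <= kappa.
  move=> h1 h2 h3 a0; rewrite -(ler_pM2r a0); lra.
have h1 := strong 0 u; have h2 := strong u 0.
rewrite subr0 in h1; rewrite sub0r normrN innerNr in h2.
apply: (num _ _ _ _ _ 0 h1 h2); last by rewrite exprn_gt0// normr_gt0.
rewrite -innerNl -innerDl (le_trans (inner_le_norm _ _))// expr2 mulrA ler_wpM2r//.
by have := lipschitz_setTP Lphi u 0; rewrite subr0.
Qed.

(** The update of z adds eta / gamma |y - x|^2 to the bracket
    <z - x, y - x> / gamma, which turns the coefficient of |y - x|^2 in the
    merit into 1 / (2 theta gamma). *)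
Lemma merit_surrogate g phi psi hund (gamma theta eta : R) (x y z ys : nat -> H) n :
    0 < gamma -> 0 < theta ->
    z n.+1 = x n.+1 + gamma *: grad phi (x n.+1) + eta *: (y n.+1 - x n.+1) ->
  DRFDR_merit phi g psi hund gamma theta eta x y z ys n.+1 =
  (g (y n.+1) + (surrogate phi psi (grad phi) (grad psi)
      (2 * (theta * gamma))^-1 (x n.+1) (y n.+1)
    - hund (y n) - inner (ys n) (y n.+1 - y n))%:E)%E.
Proof.
move=> gamma0 theta0; rewrite /DRFDR_merit /surrogate /linearization /=.
move: (grad phi (x n.+1)) (grad psi (x n.+1)) => p q zE.
rewrite [X in (X + _)%E]addeC -addeA -EFinD; congr (_ + _%:E)%E.
have -> : inner (z n.+1 - x n.+1) (y n.+1 - x n.+1) =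
    gamma * inner p (y n.+1 - x n.+1)
    + eta * `|y n.+1 - x n.+1| ^+ 2.
  by rewrite zE addrAC [x n.+1 + _]addrC addrK innerDl !innerZl sqr_normE.
move: (inner _ _) (inner _ _) (inner _ _) => i j k.
by field; rewrite !gt_eqF.
Qed.

End algorithm.

Theorem theorem3p8 (R : realType) (H : finHilbertType R)
  (alpha kappa ell gamma theta eta : R)
  (f : H -> R) (g : H -> \bar R) (hbar hund : H -> R)
  (x y z ys : nat -> H)
  (F := objective f g hbar hund)
  (L := DRFDR_merit f g hbar hund gamma theta eta x y z ys)
  (w := fun n : nat => (x n, y n, z n) : H * H * H) :
  0 <= kappa -> 0 <= ell ->
  (forall u, differentiable f u) ->
  alpha_convex alpha (EFin \o f) ->
  kappa.-lipschitz (grad f) ->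
  - kappa <= alpha ->
  proper_fun g -> lower_semicontinuous g ->
  (forall u, differentiable hbar u) ->
  ell.-lipschitz (grad hbar) ->
  continuous hund -> convex_function setT hund ->
  coercive F ->
  0 < gamma -> 0 < theta <= 1 -> 0 < eta ->
  DRFDR_seq f g hbar hund gamma theta eta x y z ys ->
  [\/ [/\ 0 < kappa,
          ell = 0 -> 0 < eta < 2,
          0 < ell -> 1 <= eta < 2 &
          0 < gamma < gamma_upper alpha kappa ell theta eta],
      [/\ 0 < kappa,
          2 <= eta < 2 + 2 * kappa / (theta * (kappa + ell)),
          ((3 * eta - 2) * theta * ell
             + 2 * Num.sqrt (2 * (eta - 2) * theta * kappa * (kappa + ell)))
            / (eta * theta + 2 - 2 * theta) < alpha &
          gamma_lower alpha kappa ell theta eta < gamma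
            < gamma_upper alpha kappa ell theta eta] |
      [/\ kappa = 0,
          0 < eta < 2,
          0 < ell -> eta <= 1 -> gamma < 1 / (theta * ell) &
          0 < ell -> 1 < eta ->
            gamma < (2 - eta) / ((3 * eta - 2) * theta * ell)]] ->
  ([/\ bounded_fun (fun n : nat => (w n.+1, ys n) : H * H * H * H),
       (\sum_(1 <= n <oo) (hnorm3 (w n.+1 - w n) ^+ 2)%:E < +oo)%E &
       w n.+1 - w n @[n --> \oo] --> (0 : H * H * H)])
  /\
  (forall xb yb zb : H, cluster (w n.+1 @[n --> \oo]) (xb, yb, zb) ->
    [/\ xb = yb,
        L n @[n --> \oo] --> F yb,
        F (y n) @[n --> \oo] --> F yb &
        [set a - b | a in limiting_subdiff
                            (fun u => (f u)%:E + g u + (hbar u)%:E)%E yb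
                   & b in convex_subdiff hund yb] 0]).
Proof.
move=> kappa0 ell0 df cf Lf alphaN gproper glsc dh Lh hund_cont _ Fcoercive
  gamma0 theta01 eta0 algo params.
have /andP[theta0 theta1] := theta01.
pose c := (2 * (theta * gamma))^-1.
pose rate := decrease_rate alpha kappa ell theta eta gamma.
have rate0 : 0 < rate by exact: decrease_rate_gt0 params.
have xP n : z n = x n.+1 + gamma *: grad f (x n.+1).
  by have [_ + _ _] := algo n; exact: (prox_smoothE gamma0 df Lf).
have zP n : z n.+1 = z n + eta *: (y n.+1 - x n.+1) by have [] := algo n.
have yP n : argmin (fun u => g u + (surrogate f hbar (grad f) (grad hbar) c
    (x n.+1) u - inner (ys n) u)%:E)%E (y n.+1).
  have [_ _ + _] := algo n; rewrite /c.
  exact: (argmin_surrogate gamma0 theta0 (xP n)).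
have ysP n : convex_subdiff hund (y n) (ys n) by have [] := algo n.
have delta0 : 0 < rate / (2 * theta * gamma * eta).
  by rewrite divr_gt0// !mulr_gt0.
have modelP n : rate / (2 * theta * gamma * eta) * `|x n.+2 - x n.+1| ^+ 2
    <= surrogate f hbar (grad f) (grad hbar) c (x n.+1) (y n.+1)
       - surrogate f hbar (grad f) (grad hbar) c (x n.+2) (y n.+1).
  apply: (merit_decrease ell0 gamma0 theta01 eta0 df Lf cf dh Lh).
  have -> : eta *: (y n.+1 - x n.+1) = z n.+1 - z n.
    by rewrite zP addrAC subrr add0r.
  by rewrite !xP scalerBr opprD addrACA.
have [sigma sigma0 sigmaP] : exists2 sigma : R, 0 < sigma &
    forall u : H, sigma * `|u| ^+ 2 <= (c - kappa / 2 - ell / 2) * `|u| ^+ 2.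
  (* on the zero space nothing relates alpha to kappa, but any sigma will do *)
  have [[u u0]|trivial] := pselect (exists u : H, u != 0).
    have small := theta_gamma_smoothness_lt1 ell0 alphaN gamma0 theta01 eta0 params
      (convexity_modulus_le u0 df Lf cf).
    exists (c - kappa / 2 - ell / 2) => //.
    have tg0 : 0 < theta * gamma by exact: mulr_gt0.
    have -> : c - kappa / 2 - ell / 2 = c * (1 - theta * gamma * (kappa + ell)).
      by rewrite /c; field; rewrite !gt_eqF.
    by rewrite mulr_gt0 ?invr_gt0 ?mulr_gt0// subr_gt0.
  exists 1 => // u; suff -> : u = 0 by rewrite normr0 expr0n !mulr0.
  by apply: contrapT => /eqP u0; apply: trivial; exists u.
have f_smooth := descent_bound df Lf.
have h_smooth := descent_bound dh Lh.
have df_lip := lipschitz_setTP Lf.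
have dh_lip := lipschitz_setTP Lh.
have f_cont : continuous f by move=> u; exact: differentiable_continuous.
have h_cont : continuous hbar by move=> u; exact: differentiable_continuous.
have meritP n : L n.+1 = (g (y n.+1) + (surrogate f hbar (grad f) (grad hbar) c
    (x n.+1) (y n.+1) - hund (y n) - inner (ys n) (y n.+1 - y n))%:E)%E.
  by apply: merit_surrogate => //; rewrite zP xP.
split; first split.
- exact: iterates_bounded f_smooth h_smooth _ _ _ _ _ _ xP yP zP ysP modelP sigmaP.
- exact: steps_square_summable f_smooth h_smooth _ _ _ _ _ _ xP yP zP ysP modelP sigmaP.
- exact: steps_cvg0 f_smooth h_smooth _ _ _ _ _ _ xP yP zP ysP modelP sigmaP.
move=> xb yb zb clu.
have [-> Ll Fl [v vhund vlim]] : _ := cluster_point_critical kappa0 gamma0 eta0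
  sigma0 delta0 f_smooth h_smooth df_lip dh_lip f_cont h_cont hund_cont gproper
  glsc Fcoercive xP yP zP ysP modelP sigmaP meritP clu.
split => //; exists v => //; exists v => //; exact: subrr.
Qed.
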